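(* Let $\alpha, \theta$ be nonconstant inner functions such that $\alpha$ divides $\theta$ and let $A\colon K^2_\theta\to K^2_\alpha$ be a bounded operator. Then $A\in\mathcal{T}(\theta,\alpha)$ if and only if there are $\psi\in K_\alpha^2$, $\chi\in K_\theta^2$ such that $$A-S_\alpha AS_\theta^*=\psi\otimes k_0^\theta+k_0^\alpha\otimes\chi.$$
   Context: $L^2=L^2(\mathbb T,m)$ with $\mathbb T$ the unit circle and $m$ normalized Lebesgue measure; $H^2\subset L^2$ is the Hardy space of the unit disc. For an inner function $u$, $K^2_u=H^2\ominus uH^2$, $P_u\colon L^2\to K^2_u$ is the orthogonal projection, $k_0^u=1-\overline{u(0)}\,u\in K_u^2$, and $S_u\colon K_u^2\to K_u^2$, $S_uf=P_u(zf)$, is the compressed shift. $\alpha$ divides $\theta$ means that $\theta/\alpha=\bar\alpha\theta$ is inner. $(x\otimes y)f=\langle f,y\rangle x$. For $\varphi\in L^2$, $A_\varphi^{\theta,\alpha}f=P_\alpha(\varphi f)$ with domain $\{f\in K^2_\theta:\varphi f\in L^2\}$, which contains the dense subspace $K^2_\theta\cap H^\infty$; if it is bounded, $A_\varphi^{\theta,\alpha}$ also denotes its unique bounded extension $K^2_\theta\to K^2_\alpha$. $\mathcal T(\theta,\alpha)$ is the space of all bounded operators $K^2_\theta\to K^2_\alpha$ so obtained with $\varphi\in L^2$. *)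

(* Defs.v *)
From HB Require Import structures.
From mathcomp Require Import all_boot all_order all_algebra.
From mathcomp Require Import all_classical all_reals all_analysis.
From mathcomp Require Import generic_quotient ring_quotient.
From mathcomp Require Import measurable_realfun complex.

Set Implicit Arguments.
Unset Strict Implicit.
Unset Printing Implicit Defensive.

Import Order.TTheory GRing.Theory Num.Theory.
Import Normc.

Local Open Scope classical_set_scope.
Local Open Scope ring_scope.
Local Open Scope complex_scope.
Local Open Scope quotient_scope.

Record circle (R : realType) := Circle {
  circle_val :> R[i];
  circle_normc : normc circle_val == 1 }.

Section Circle.
Variable R : realType.

HB.instance Definition _ := [isSub for @circle_val R].
HB.instance Definition _ := [Choice of circle R by <:].

Let normc1' : normc (1 : R[i]) == 1.
Proof. by rewrite normc1. Qed.

HB.instance Definition _ := isPointed.Build (circle R) (Circle normc1').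

Let circle_exp_proof (t : R) :
  normc (cos (2 * trigo.pi * t) +i* sin (2 * trigo.pi * t)) == 1.
Proof. by rewrite /= cos2Dsin2 sqrtr1. Qed.

Definition circle_exp (t : R) : circle R := Circle (circle_exp_proof t).

(* [circle_exp] restricts to a Borel isomorphism of [0, 1[ onto the circle, so
   this is the Borel sigma-algebra of the circle. *)
Definition circle_measurable : set (set (circle R)) :=
  [set A | measurable (circle_exp @^-1` A : set (measurableTypeR R))].

Let circle_measurable0 : circle_measurable set0.
Proof. by rewrite /circle_measurable /= preimage_set0. Qed.

Let circle_measurableC A :
  circle_measurable A -> circle_measurable (~` A).
Proof. by rewrite /circle_measurable /= preimage_setC => /measurableC. Qed.

Let circle_measurable_bigcup (F : (set (circle R))^nat) :
  (forall i, circle_measurable (F i)) -> circle_measurable (\bigcup_i F i).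
Proof.
move=> mF; rewrite /circle_measurable /= preimage_bigcup.
by apply: bigcup_measurable => i _; exact: mF.
Qed.

Definition circle_display : measure_display. Proof. exact. Qed.

HB.instance Definition _ := @isMeasurable.Build circle_display (circle R)
  circle_measurable circle_measurable0 circle_measurableC circle_measurable_bigcup.

Lemma measurable_circle_exp :
  measurable_fun [set: measurableTypeR R] circle_exp.
Proof. by move=> _ A mA; rewrite setTI. Qed.

HB.instance Definition _ := @isMeasurableFun.Build _ _ _ _ circle_exp
  measurable_circle_exp.

Definition circle_measure : set (circle R) -> \bar R :=
  pushforward (mrestr (@lebesgue_measure R) (measurable_itv `[0, 1[)) circle_exp.

Let circle_measure_is_pushforward : {measure set (circle R) -> \bar R} :=
  measure_function_pushforward__canonical__measure_function_Measure
    (mrestr (@lebesgue_measure R) (measurable_itv `[0, 1[)) measurable_circle_exp.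

HB.instance Definition _ := isMeasure.Build _ _ _ circle_measure
  (measure0 circle_measure_is_pushforward)
  (@measure_ge0 _ _ _ circle_measure_is_pushforward)
  (@measure_semi_sigma_additive _ _ _ circle_measure_is_pushforward).

Lemma circle_measure_setT : circle_measure setT = 1%E.
Proof.
rewrite /circle_measure /pushforward preimage_setT /mrestr setTI.
by rewrite lebesgue_measure_itv/= lte_fin ltr01 sube0.
Qed.

HB.instance Definition _ := Measure_isProbability.Build _ _ _
  circle_measure circle_measure_setT.

End Circle.

Section MeasurableFunctions.
Variable R : realType.
Local Notation C := R[i].
Local Notation m := (@circle_measure R).
Local Notation Re := (@complex.Re R).
Local Notation Im := (@complex.Im R).

Definition cmeasurable : {pred circle R -> C} := mem [set f |
  measurable_fun setT (fun x => Re (f x)) /\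
  measurable_fun setT (fun x => Im (f x))].

Let ReB (z w : C) : Re (z - w) = Re z - Re w.
Proof. by case: z w => [a b] [c d]. Qed.

Let ImB (z w : C) : Im (z - w) = Im z - Im w.
Proof. by case: z w => [a b] [c d]. Qed.

Let ReM (z w : C) : Re (z * w) = Re z * Re w - Im z * Im w.
Proof. by case: z w => [a b] [c d]. Qed.

Let ImM (z w : C) : Im (z * w) = Re z * Im w + Im z * Re w.
Proof. by case: z w => [a b] [c d]. Qed.

Let cmeasurable_subring : subring_closed cmeasurable.
Proof.
split=> [|f g|f g]; rewrite ?inE /=.
- by split; exact: measurable_cst.
- move=> [rf jf] [rg jg]; split.
    under eq_fun do rewrite ReB.
    exact: measurable_funB.
  under eq_fun do rewrite ImB.
  exact: measurable_funB.
- move=> [rf jf] [rg jg]; split.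
    under eq_fun do rewrite ReM.
    by apply: measurable_funB; exact: measurable_funM.
  under eq_fun do rewrite ImM.
  by apply: measurable_funD; exact: measurable_funM.
Qed.

HB.instance Definition _ := GRing.isSubringClosed.Build _ cmeasurable
  cmeasurable_subring.

Record cmfun := CMFun {
  cmfun_val :> circle R -> C;
  cmfun_proof : cmfun_val \in cmeasurable }.

HB.instance Definition _ := [isSub for cmfun_val].
HB.instance Definition _ := [Choice of cmfun by <:].
HB.instance Definition _ := [SubChoice_isSubComNzRing of cmfun by <:].

Definition ae_zero : {pred cmfun} := mem [set f : cmfun | {ae m, forall x, f x = 0}].

Let ae_zero_ideal : idealr_closed ae_zero.
Proof.
split=> [||a f g]; rewrite ?inE /=.
- exact: aeW.
- apply/negP => /set_mem/= [N [mN N0 sN]].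
  have : (m setT <= m N)%E.
    apply: le_measure; rewrite ?inE//.
    by move=> x _; apply: sN => /=; exact/eqP/oner_neq0.
  by rewrite N0 probability_setT lee_fin ler10.
- move=> f0 g0; apply: filterS2 f0 g0 => x /= f0 g0.
  transitivity (a x * f x + g x) => //.
  by rewrite f0 g0 mulr0 addr0.
Qed.

HB.instance Definition _ := isIdealr.Build _ ae_zero ae_zero_ideal.

End MeasurableFunctions.

(* Measurable functions on the circle up to equality almost everywhere.  This
   is a ring, so a product of two elements of L^2 always makes sense, whether or
   not it belongs to L^2. *)
Definition L0 (R : realType) : Type := {ideal_quot (@ae_zero R)}.

HB.instance Definition _ (R : realType) := GRing.ComNzRing.on (L0 R).
HB.instance Definition _ (R : realType) := EqQuotient.on (L0 R).

Definition L0_fun (R : realType) (f : L0 R) : circle R -> R[i] := repr f.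
Coercion L0_fun : L0 >-> Funclass.

Section L0Module.
Variable R : realType.
Local Notation C := R[i].

Let cst_measurable (c : C) : (fun=> c) \in @cmeasurable R.
Proof. by rewrite inE; split; exact: measurable_cst. Qed.

Definition cmfun_cst (c : C) : cmfun R := CMFun (cst_measurable c).

Definition L0_scale (c : C) (f : L0 R) : L0 R := \pi_(L0 R) (cmfun_cst c) * f.

Let L0_scaleA a b f : L0_scale a (L0_scale b f) = L0_scale (a * b) f.
Proof.
rewrite /L0_scale mulrA; congr (_ * _).
by rewrite -[LHS]pi_mulr; congr (\pi _); exact: val_inj.
Qed.

Let L0_scale1 : left_id 1 L0_scale.
Proof.
move=> f; rewrite /L0_scale -[RHS]mul1r; congr (_ * _).
by rewrite -[RHS]pi_oner; congr (\pi _); exact: val_inj.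
Qed.

Let L0_scaleDr : right_distributive L0_scale +%R.
Proof. by move=> a f g; rewrite /L0_scale mulrDr. Qed.

Let L0_scaleDl f : {morph L0_scale^~ f : a b / a + b}.
Proof.
move=> a b; rewrite /L0_scale -mulrDl; congr (_ * _).
by rewrite -[RHS]pi_addr; congr (\pi _); exact: val_inj.
Qed.

HB.instance Definition _ := GRing.Zmodule_isLmodule.Build C (L0 R)
  L0_scaleA L0_scale1 L0_scaleDr L0_scaleDl.

End L0Module.

Section CoordinateAndConjugate.
Variable R : realType.

Let id_measurable : @circle_val R \in @cmeasurable R.
Proof.
have mt : measurable_fun setT (fun t : R => 2 * trigo.pi * t).
  by apply: measurable_funM; [exact: measurable_cst|exact: measurable_id].
have mc : measurable_fun setT (fun t : R => cos (2 * trigo.pi * t)).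
  apply: (measurableT_comp (f := @cos R)) mt.
  by apply: continuous_measurable_fun => x; exact: continuous_cos.
have ms : measurable_fun setT (fun t : R => sin (2 * trigo.pi * t)).
  apply: (measurableT_comp (f := @sin R)) mt.
  by apply: continuous_measurable_fun => x; exact: continuous_sin.
rewrite inE; split=> _ B mB; rewrite setTI.
- have := mc measurableT B mB; by rewrite setTI.
- have := ms measurableT B mB; by rewrite setTI.
Qed.

Definition L0_z : L0 R := \pi_(L0 R) (CMFun id_measurable).

Let conj_measurable (f : cmfun R) : (fun x => conjc (f x)) \in @cmeasurable R.
Proof.
have := cmfun_proof f; rewrite !inE => -[/= rf jf]; split => /=.
  rewrite (_ : (fun x => _) = (fun x => complex.Re (f x)))//.
  by apply/funext => x; case: (f x).
rewrite (_ : (fun x => _) = \- (fun x => complex.Im (f x))).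
  exact: measurable_funN.
by apply/funext => x /=; case: (f x).
Qed.

Definition cmfun_conj (f : cmfun R) : cmfun R := CMFun (conj_measurable f).

Definition L0_conj (f : L0 R) : L0 R := \pi_(L0 R) (cmfun_conj (repr f)).

End CoordinateAndConjugate.

Arguments L0_z {R}.

Section HardySpace.
Variable R : realType.
Local Notation C := R[i].
Local Notation m := (@circle_measure R).
Implicit Types (f g u : L0 R) (U K : set (L0 R)).

Definition L2 : set (L0 R) :=
  [set f | finite_norm m 2%:E (fun x => normc (f x))].

Definition L2_norm f : R := fine (Lnorm m 2%:E (fun x => (normc (f x))%:E)).

Definition cintegral f : C :=
  (\int[m]_x complex.Re (f x)) +i* (\int[m]_x complex.Im (f x)).

(* Meaningful for f and g in L^2 only. *)
Definition L2_dot f g : C := cintegral (f * L0_conj g).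

Definition L0_zpow (n : int) : L0 R :=
  match n with
  | Posz k => L0_z ^+ k
  | Negz k => L0_conj L0_z ^+ k.+1
  end.

Definition fourier f (n : int) : C := L2_dot f (L0_zpow n).

(* H^2 of the disc, identified with the space of its boundary functions. *)
Definition H2 : set (L0 R) :=
  [set f | L2 f /\ forall n : int, n < 0 -> fourier f n = 0].

(* The value at a point w of the open unit disc of the holomorphic function whose
   boundary function is f. *)
Definition disc_value f (w : C) : C :=
  limn (fun n => \sum_(k < n) fourier f k%:Z * w ^+ k : C^o).

Definition inner_function u :=
  H2 u /\ {ae m, forall x, normc (u x) = 1}.

Definition nonconstant u := forall c : C, u <> c *: (1 : L0 R).

(* a divides t when t / a, which is conj(a) t on the circle, is inner. *)
Definition inner_divides (a t : L0 R) := inner_function (L0_conj a * t).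

Definition model_space u : set (L0 R) :=
  [set f | H2 f /\ forall g, H2 g -> L2_dot f (u * g) = 0].

Definition orthoproj K f : L0 R :=
  xget 0 [set g | K g /\ forall h, K h -> L2_dot (f - g) h = 0].

Definition model_proj u f : L0 R := orthoproj (model_space u) f.

Definition k0 u : L0 R := 1 - conjc (disc_value u 0) *: u.

Definition compressed_shift u f : L0 R := model_proj u (L0_z * f).

Definition rank_one (x y f : L0 R) : L0 R := L2_dot f y *: x.

(* Operators are functions on the whole of [L0 R]; only their values on the
   stated domain are meaningful. *)
Definition bounded_on U (A : L0 R -> L0 R) :=
  exists c : R, forall f, U f -> L2_norm (A f) <= c * L2_norm f.

Definition bounded_operator U K (A : L0 R -> L0 R) :=
  [/\ forall f, U f -> K (A f),
      forall (c : C) f g, U f -> U g -> A (c *: f + g) = c *: A f + A g &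
      bounded_on U A].

(* The adjoint of an operator A with domain K. *)
Definition adjoint K (A : L0 R -> L0 R) g : L0 R :=
  xget 0 [set h | K h /\ forall f, K f -> L2_dot (A f) g = L2_dot f h].

(* A_phi^{t, a} *)
Definition ATTO_dom (phi t : L0 R) : set (L0 R) :=
  [set f | model_space t f /\ L2 (phi * f)].

Definition ATTO (phi a f : L0 R) : L0 R := model_proj a (phi * f).

(* The domain of A_phi is dense in K_t, so that A is the unique bounded extension
   of A_phi. *)
Definition ATTO_class (t a : L0 R) : set (L0 R -> L0 R) :=
  [set A | bounded_operator (model_space t) (model_space a) A /\
     exists phi, [/\ L2 phi, bounded_on (ATTO_dom phi t) (ATTO phi a) &
       forall f, ATTO_dom phi t f -> A f = ATTO phi a f]].

End HardySpace.

(* Main.v *)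
Require Import Defs.
From mathcomp Require Import all_boot all_order all_algebra.
From mathcomp Require Import all_classical all_reals all_analysis.
From mathcomp Require Import measurable_realfun complex ring lra zify.

Set Implicit Arguments.
Unset Strict Implicit.
Unset Printing Implicit Defensive.

Import Order.TTheory GRing.Theory Num.Theory.
Import numFieldNormedType.Exports.
Import Normc.

Local Open Scope classical_set_scope.
Local Open Scope ring_scope.
Local Open Scope complex_scope.
Local Open Scope quotient_scope.

(** The proof works with sesquilinear forms. Let [B f = conj z (f - f_0)] be the
    backward shift, where [f_0] is the Fourier coefficient of index 0. It maps every
    model space into itself and is there the adjoint of the compressed shift
    ([adjoint_shift]); moreover [<f, k0 theta> = f_0] on the model space of [theta]
    ([dot_k0]). Hence [A] satisfies the operator identity if and only if

      [<A f, h> - <A (B f), B h> = f_0 <psi, h> + conj h_0 <f, chi>]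

    for all [f] and [h] in the two model spaces ([defect_formP]).

    If [A] has the symbol [phi], then [<A f, h>] is the integral of [phi f conj h]
    for bounded [f]. On the circle [B f conj (B h) = (f - f_0) conj (h - h_0)], and
    expanding this product gives the identity with [psi] the projection of [phi] and
    [chi] that of [conj phi], up to a multiple of [k0 theta] ([toeplitz_defect]). It
    extends to all [f] because bounded functions are dense in a model space
    ([ATTO_defect]).

    Conversely, [N] steps of the identity give

      [<A f, h> - <A (B^N f), B^N h> = <psi s_N f, h> + <f, chi s_N h>],

    where [s_N] is the Taylor partial sum ([defect_iter]). Since
    [B^N f = conj z^N (f - s_N f)] tends to 0 in norm, the limit for bounded [f] and
    [h] is [<A f, h> = <phi f, h>] with [phi = psi + conj chi]; by density [A] is the
    operator of symbol [phi] on its whole domain ([defect_ATTO]).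

    Density ([model_approx_cvg]) comes from the conjugation [f |-> u conj z conj f],
    which preserves the model space of [u]: it turns Taylor polynomials into
    combinations of the functions [conj z^(k + 1) u], and their projections onto [H2]
    are the bounded functions [B^(k + 1) u].

    Projections onto [H2] and onto model spaces exist because [L2] is complete
    ([L2_complete], by almost everywhere convergence of a subsequence and Fatou's
    lemma) and because a function with zero Fourier coefficients is zero
    ([fourier_unique]). For the latter, such a function is orthogonal to the
    trigonometric polynomials [(1 - p^n)^(2^n)], where [p] has values in [[0, 1]] and
    is smaller than [1/2] exactly on a given arc from the point 1. These converge
    boundedly to the indicator of the arc, so the function has integral 0 on every
    such arc, and it vanishes by the Lebesgue differentiation theorem. *)

(** * Classes of measurable functions and their integrals *)

Section AE.
Variable R : realType.
Local Notation C := R[i].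
Local Notation m := (@circle_measure R).
Local Notation Re := (@complex.Re R).
Local Notation Im := (@complex.Im R).
Implicit Types (f g : L0 R) (c : C).

Definition L0_cst c : L0 R := \pi_(L0 R) (cmfun_cst c).

Lemma pi_ae (F : cmfun R) : {ae m, forall x, (\pi_(L0 R) F : L0 R) x = F x}.
Proof.
have : repr (\pi_(L0 R) F) = F %[mod L0 R] by rewrite reprK.
move=> /eqP; rewrite /L0 -Quotient.idealrBE inE /=.
by apply: filterS => x /= /eqP; rewrite subr_eq0 => /eqP.
Qed.

Lemma L0_ext f g : {ae m, forall x, f x = g x} -> f = g.
Proof.
move=> fg; rewrite -[f]reprK -[g]reprK; apply/eqP.
rewrite /L0 -Quotient.idealrBE inE /=.
apply: filterS fg => x fg; apply/eqP; rewrite subr_eq0; exact/eqP.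
Qed.

Lemma L0D_ae f g : {ae m, forall x, L0_fun (f + g) x = f x + g x}.
Proof.
have -> : f + g = \pi_(L0 R) (repr f + repr g) by rewrite rmorphD /= !reprK.
exact: pi_ae.
Qed.

Lemma L0N_ae f : {ae m, forall x, L0_fun (- f) x = - f x}.
Proof.
have -> : - f = \pi_(L0 R) (- repr f) by rewrite rmorphN /= !reprK.
exact: pi_ae.
Qed.

Lemma L0M_ae f g : {ae m, forall x, L0_fun (f * g) x = f x * g x}.
Proof.
have -> : f * g = \pi_(L0 R) (repr f * repr g) by rewrite rmorphM /= !reprK.
exact: pi_ae.
Qed.

Lemma L0conj_ae f : {ae m, forall x, L0_conj f x = conjc (f x)}.
Proof. exact: pi_ae. Qed.

Lemma L0cst_ae c : {ae m, forall x, L0_cst c x = c}.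
Proof. exact: pi_ae. Qed.

Lemma L0z_ae : {ae m, forall x, (L0_z : L0 R) x = circle_val x}.
Proof. exact: pi_ae. Qed.

Lemma cstD c d : L0_cst (c + d) = L0_cst c + L0_cst d.
Proof. by rewrite /L0_cst -rmorphD; congr (\pi _); exact: val_inj. Qed.
Lemma cstN c : L0_cst (- c) = - L0_cst c.
Proof. by rewrite /L0_cst -rmorphN; congr (\pi _); exact: val_inj. Qed.
Lemma cst1 : L0_cst 1 = 1.
Proof. by rewrite /L0_cst -[RHS](rmorph1 \pi_(L0 R)); congr (\pi _); exact: val_inj. Qed.
Lemma cst0 : L0_cst 0 = 0.
Proof. by rewrite /L0_cst -[RHS](rmorph0 \pi_(L0 R)); congr (\pi _); exact: val_inj. Qed.
Lemma L0_scaleE c f : c *: f = L0_cst c * f. Proof. by []. Qed.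

Lemma L0_conjD f g : L0_conj (f + g) = L0_conj f + L0_conj g.
Proof.
apply: L0_ext; near=> x.
rewrite (near (L0conj_ae (f + g)) x)// (near (L0D_ae f g) x)//.
rewrite (near (L0D_ae (L0_conj f) (L0_conj g)) x)//.
by rewrite (near (L0conj_ae f) x)// (near (L0conj_ae g) x)// rmorphD.
Unshelve. all: by end_near. Qed.

Lemma L0_conjM f g : L0_conj (f * g) = L0_conj f * L0_conj g.
Proof.
apply: L0_ext; near=> x.
rewrite (near (L0conj_ae (f * g)) x)// (near (L0M_ae f g) x)//.
rewrite (near (L0M_ae (L0_conj f) (L0_conj g)) x)//.
by rewrite (near (L0conj_ae f) x)// (near (L0conj_ae g) x)// rmorphM.
Unshelve. all: by end_near. Qed.

Lemma cst_conj c : L0_conj (L0_cst c) = L0_cst (conjc c).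
Proof.
apply: L0_ext; near=> x.
by rewrite (near (L0conj_ae (L0_cst c)) x)// (near (L0cst_ae c) x)//
  (near (L0cst_ae (conjc c)) x).
Unshelve. all: by end_near. Qed.

Lemma L0_conjK f : L0_conj (L0_conj f) = f.
Proof.
apply: L0_ext; near=> x.
by rewrite (near (L0conj_ae (L0_conj f)) x)// (near (L0conj_ae f) x)// conjcK.
Unshelve. all: by end_near. Qed.

Lemma L0_conj1 : L0_conj (1 : L0 R) = 1.
Proof. by rewrite -cst1 cst_conj conjc1. Qed.
Lemma L0_conj0 : L0_conj (0 : L0 R) = 0.
Proof. by rewrite -cst0 cst_conj conjc0. Qed.
Lemma L0_conjN f : L0_conj (- f) = - L0_conj f.
Proof. by apply/eqP; rewrite -addr_eq0 -L0_conjD addNr L0_conj0. Qed.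
Lemma L0_conjB f g : L0_conj (f - g) = L0_conj f - L0_conj g.
Proof. by rewrite L0_conjD L0_conjN. Qed.
Lemma L0_conjZ c f : L0_conj (c *: f) = conjc c *: L0_conj f.
Proof. by rewrite !L0_scaleE L0_conjM cst_conj. Qed.

Lemma mulc_conj (c : C) : c * conjc c = (normc c ^+ 2)%:C.
Proof.
case: c => a b /=; rewrite sqr_sqrtr ?addr_ge0 ?sqr_ge0//.
by apply/eqP; rewrite eq_complex /=; apply/andP; split; apply/eqP; ring.
Qed.

Lemma unimod_conj f : {ae m, forall x, normc (f x) = 1} -> f * L0_conj f = 1.
Proof.
move=> f1; rewrite -cst1; apply: L0_ext; near=> x.
rewrite (near (L0M_ae f (L0_conj f)) x)// (near (L0conj_ae f) x)//.
by rewrite mulc_conj (near f1 x)// expr1n (near (L0cst_ae 1) x).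
Unshelve. all: by end_near. Qed.

Lemma z_unimod : {ae m, forall x, normc ((L0_z : L0 R) x) = 1}.
Proof. by apply: filterS L0z_ae => x ->; apply/eqP; case: x. Qed.

Lemma mul_z_conj : (L0_z : L0 R) * L0_conj L0_z = 1.
Proof. exact/unimod_conj/z_unimod. Qed.

Definition L1 : set (L0 R) :=
  [set f | m.-integrable setT (fun x => (normc (f x))%:E)].

Lemma measurable_Re f : measurable_fun setT (fun x => Re (f x)).
Proof. by have := cmfun_proof (repr f); rewrite inE => -[]. Qed.
Lemma measurable_Im f : measurable_fun setT (fun x => Im (f x)).
Proof. by have := cmfun_proof (repr f); rewrite inE => -[]. Qed.

Lemma normc_ReIm (c : C) : normc c = Num.sqrt (Re c ^+ 2 + Im c ^+ 2).
Proof. by case: c. Qed.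
Lemma normc_sqr (c : C) : normc c ^+ 2 = Re c ^+ 2 + Im c ^+ 2.
Proof. by rewrite normc_ReIm sqr_sqrtr// addr_ge0// sqr_ge0. Qed.
Lemma normc_ge0 (c : C) : 0 <= normc c.
Proof. by rewrite normc_ReIm sqrtr_ge0. Qed.
Lemma Re_normc (c : C) : `|Re c| <= normc c.
Proof. by rewrite normc_ReIm -sqrtr_sqr ler_wsqrtr// lerDl sqr_ge0. Qed.
Lemma Im_normc (c : C) : `|Im c| <= normc c.
Proof. by rewrite normc_ReIm -sqrtr_sqr ler_wsqrtr// lerDr sqr_ge0. Qed.
Lemma normc_conj (c : C) : normc (conjc c) = normc c.
Proof. by case: c => a b /=; rewrite sqrrN. Qed.

Lemma measurable_normc f : measurable_fun setT (fun x => normc (f x)).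
Proof.
under eq_fun do rewrite normc_ReIm.
apply: (measurableT_comp (f := @Num.sqrt R)).
  by apply: continuous_measurable_fun => x; exact: sqrt_continuous.
by apply: measurable_funD; apply: measurable_funX; [exact: measurable_Re|exact:
  measurable_Im].
Qed.

(** Sums and products of classes are known almost everywhere only, so their
    integrability is obtained by domination almost everywhere. *)
Lemma L1_dom f (h : circle R -> R) : m.-integrable setT (EFin \o h) ->
  {ae m, forall x, normc (f x) <= h x} -> L1 f.
Proof.
move=> ih fh; apply/integrableP; split.
  by apply/measurable_EFinP; exact: measurable_normc.
have /integrableP[mh lh] := ih.
apply: le_lt_trans lh; apply: ae_ge0_le_integral => //.
- apply: measurableT_comp => //; apply/measurable_EFinP; exact: measurable_normc.
- exact: measurableT_comp.
- apply: filterS fh => x hx _ /=.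
  by rewrite lee_fin ger0_norm ?normc_ge0// (le_trans hx)// ler_norm.
Qed.

Lemma L1_Re f : L1 f -> m.-integrable setT (EFin \o (fun x => Re (f x))).
Proof.
apply: le_integrable => //; first by apply/measurable_EFinP; exact: measurable_Re.
move=> x _ /=; rewrite lee_fin (ger0_norm (normc_ge0 _)); exact: Re_normc.
Qed.

Lemma L1_Im f : L1 f -> m.-integrable setT (EFin \o (fun x => Im (f x))).
Proof.
apply: le_integrable => //; first by apply/measurable_EFinP; exact: measurable_Im.
move=> x _ /=; rewrite lee_fin (ger0_norm (normc_ge0 _)); exact: Im_normc.
Qed.

Lemma integrable_lincomb (h k : circle R -> R) : m.-integrable setT (EFin \o h) ->
  m.-integrable setT (EFin \o k) -> forall a b,
  m.-integrable setT (EFin \o (fun x => a * h x + b * k x)).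
Proof.
move=> ih ik a b.
rewrite (_ : EFin \o _ = (fun x => a%:E * (h x)%:E) \+ (fun x => b%:E * (k x)%:E))%E.
  by apply: integrableD => //; apply: integrableZl.
by apply/funext => x.
Qed.

Lemma Rintegral_lincomb (h k : circle R -> R) : m.-integrable setT (EFin \o h) ->
  m.-integrable setT (EFin \o k) -> forall a b,
  \int[m]_x (a * h x + b * k x) = a * \int[m]_x h x + b * \int[m]_x k x.
Proof.
move=> ih ik a b; rewrite RintegralD//.
- by rewrite !RintegralZl.
- by apply: (integrableZl measurableT a ih).
- by apply: (integrableZl measurableT b ik).
Qed.

Lemma L1Z c f : L1 f -> L1 (c *: f).
Proof.
move=> lf; apply: (@L1_dom _ (fun x => normc c * normc (f x) + 0 * normc (f x))).
  exact: integrable_lincomb.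
apply: filterS2 (L0M_ae (L0_cst c) f) (L0cst_ae c) => x.
by rewrite -L0_scaleE => -> ->; rewrite normcM mul0r addr0.
Qed.

Lemma L1N f : L1 f -> L1 (- f).
Proof. by move=> lf; rewrite -scaleN1r; exact: L1Z. Qed.

Lemma ae_eq_Rintegral (h k : circle R -> R) : measurable_fun setT h ->
  measurable_fun setT k -> {ae m, forall x, h x = k x} ->
  \int[m]_x h x = \int[m]_x k x.
Proof.
move=> mh mk hk; congr fine; apply: ae_eq_integral => //.
- exact/measurable_EFinP.
- exact/measurable_EFinP.
- by apply: filterS hk => x -> _.
Qed.

Lemma cintegralD f g : L1 f -> L1 g ->
  cintegral (f + g) = cintegral f + cintegral g.
Proof.
move=> lf lg; have h := L0D_ae f g.
apply/eqP; rewrite eq_complex/=; apply/andP; split; apply/eqP.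
  rewrite -RintegralD//; [|exact: L1_Re|exact: L1_Re].
  apply: ae_eq_Rintegral; first exact: measurable_Re.
  - by apply: measurable_funD; exact: measurable_Re.
  - by apply: filterS h => x ->; case: (f x) (g x) => [? ?] [].
rewrite -RintegralD//; [|exact: L1_Im|exact: L1_Im].
apply: ae_eq_Rintegral; first exact: measurable_Im.
- by apply: measurable_funD; exact: measurable_Im.
- by apply: filterS h => x ->; case: (f x) (g x) => [? ?] [].
Qed.

Lemma cintegralZ c f : L1 f -> cintegral (c *: f) = c * cintegral f.
Proof.
move=> lf.
have h : {ae m, forall x, L0_fun (c *: f) x = c * f x}.
  apply: filterS2 (L0M_ae (L0_cst c) f) (L0cst_ae c) => x.
  by rewrite -L0_scaleE => -> ->.
case: c h => a b h.
apply/eqP; rewrite eq_complex/=; apply/andP; split; apply/eqP.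
  transitivity (\int[m]_x (a * Re (f x) + (- b) * Im (f x))).
    apply: ae_eq_Rintegral; first exact: measurable_Re.
    - by apply: measurable_funD; apply: measurable_funM => //; [exact:
      measurable_Re|exact: measurable_Im].
    - by apply: filterS h => x ->; case: (f x) => u v /=; rewrite mulNr.
  by rewrite Rintegral_lincomb ?mulNr//; [exact: L1_Re|exact: L1_Im].
transitivity (\int[m]_x (a * Im (f x) + b * Re (f x))).
  apply: ae_eq_Rintegral; first exact: measurable_Im.
  - by apply: measurable_funD; apply: measurable_funM => //; [exact:
    measurable_Im|exact: measurable_Re].
  - by apply: filterS h => x ->; case: (f x) => u v /=.
by rewrite Rintegral_lincomb//; [exact: L1_Im|exact: L1_Re].
Qed.

Lemma cintegral_conj f : L1 f -> cintegral (L0_conj f) = conjc (cintegral f).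
Proof.
move=> lf; have h := L0conj_ae f.
apply/eqP; rewrite eq_complex/=; apply/andP; split; apply/eqP.
  apply: ae_eq_Rintegral; [exact: measurable_Re|exact: measurable_Re|].
  by apply: filterS h => x ->; case: (f x).
rewrite -mulN1r -RintegralZl//; last exact: L1_Im.
apply: ae_eq_Rintegral; [exact: measurable_Im| |].
- by apply: measurable_funM => //; exact: measurable_Im.
- by apply: filterS h => x ->; case: (f x) => u v /=; rewrite mulN1r.
Qed.

Lemma cintegralN f : L1 f -> cintegral (- f) = - cintegral f.
Proof. by move=> lf; rewrite -scaleN1r cintegralZ// mulN1r. Qed.

Lemma cintegralB f g : L1 f -> L1 g -> cintegral (f - g) = cintegral f - cintegral g.
Proof. by move=> lf lg; rewrite cintegralD ?cintegralN//; exact: L1N. Qed.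

(** The squared norm is what is additive on orthogonal sums, and what dominated
    and monotone limits control; [L2_normE] relates it to [L2_norm]. *)
Definition nsq f : R := \int[m]_x (normc (f x) ^+ 2).

Lemma sqr_ae f : {ae m, forall x, L0_fun (f * L0_conj f) x = (normc (f x) ^+ 2)%:C}.
Proof.
apply: filterS2 (L0M_ae f (L0_conj f)) (L0conj_ae f) => x -> ->.
by rewrite mulc_conj.
Qed.

Lemma measurable_normc_sqr f : measurable_fun setT (fun x => normc (f x) ^+ 2).
Proof. by apply: measurable_funX; exact: measurable_normc. Qed.

Lemma Lnorm2E f : Lnorm m 2%:E (fun x => (normc (f x))%:E) =
  ((\int[m]_x (normc (f x) ^+ 2)%:E) `^ 2^-1)%E.
Proof.
rewrite unlock; congr poweR; apply: eq_integral => x _.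
by rewrite /= ger0_norm ?normc_ge0// powR_mulrn ?normc_ge0.
Qed.

Lemma L2_sqr f : L2 f <-> m.-integrable setT (EFin \o (fun x => normc (f x) ^+ 2)).
Proof.
have e : (\int[m]_x `|(normc (f x) ^+ 2)%:E| = \int[m]_x (normc (f x) ^+ 2)%:E)%E.
  by apply: eq_integral => x _; rewrite gee0_abs ?lee_fin ?sqr_ge0.
rewrite /L2 /= /finite_norm Lnorm2E.
split=> [h|/integrableP[_ h]].
- apply/integrableP; split; first by apply/measurable_EFinP; exact: measurable_normc_sqr.
  rewrite [X in (X < _)%E]e ltey; apply/eqP => h'; move: h.
  by rewrite h' poweRyr ?invr_eq0.
- by apply: poweR_lty; rewrite -e.
Qed.

Lemma L2_normE f : L2 f -> L2_norm f = Num.sqrt (nsq f).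
Proof.
move=> /L2_sqr lf; rewrite /L2_norm Lnorm2E.
rewrite -(fineK (integrable_fin_num measurableT lf)) /= powR12_sqrt//.
by apply: fine_ge0; apply: integral_ge0 => x _; rewrite lee_fin sqr_ge0.
Qed.

(** Because [|f g| <= |f|^2 + |g|^2]. *)
Lemma L2M_L1 f g : L2 f -> L2 g -> L1 (f * g).
Proof.
move=> /L2_sqr lf /L2_sqr lg.
apply: (@L1_dom _ (fun x => 1 * (normc (f x) ^+ 2) + 1 * (normc (g x) ^+ 2))).
  exact: integrable_lincomb.
apply: filterS (L0M_ae f g) => x ->; rewrite normcM !mul1r.
have := normc_ge0 (f x); have := normc_ge0 (g x).
move: (normc (f x)) (normc (g x)) => a b; nra.
Qed.

Lemma nsqE f : L2 f -> L2_dot f f = (nsq f)%:C.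
Proof.
move=> lf; rewrite /L2_dot /nsq; have h := sqr_ae f.
apply/eqP; rewrite eq_complex/=; apply/andP; split; apply/eqP.
  apply: ae_eq_Rintegral; [exact: measurable_Re|exact: measurable_normc_sqr|].
  by apply: filterS h => x ->.
rewrite -[RHS](mul0r (fine (m setT))) -Rintegral_cst//.
apply: ae_eq_Rintegral; [exact: measurable_Im|exact: measurable_cst|].
by apply: filterS h => x ->.
Qed.

Lemma nsq_ge0 f : 0 <= nsq f.
Proof. by apply: Rintegral_ge0 => x _; exact: sqr_ge0. Qed.

Lemma nsq_eq0 f : L2 f -> nsq f = 0 -> f = 0.
Proof.
move=> /L2_sqr lf h.
have mf : measurable_fun setT (fun x => (normc (f x) ^+ 2)%:E).
  by apply/measurable_EFinP; exact: measurable_normc_sqr.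
have : (\int[m]_x `|(normc (f x) ^+ 2)%:E| = 0)%E.
  under eq_integral do rewrite gee0_abs ?lee_fin ?sqr_ge0//.
  rewrite -(fineK (integrable_fin_num measurableT lf)).
  by rewrite /nsq /Rintegral in h; rewrite h.
move=> /(ae_eq_integral_abs m measurableT mf) h0; rewrite -cst0; apply: L0_ext.
apply: filterS2 h0 (L0cst_ae 0) => x /(_ I) /= [] /eqP; rewrite sqrf_eq0 => /eqP
  /eq0_normc -> ->//.
Qed.

Lemma L2_dom f (h : circle R -> R) : m.-integrable setT (EFin \o h) ->
  {ae m, forall x, normc (f x) ^+ 2 <= h x} -> L2 f.
Proof.
move=> ih fh; apply/L2_sqr; apply/integrableP; split.
  by apply/measurable_EFinP; exact: measurable_normc_sqr.
have /integrableP[mh lh] := ih.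
apply: le_lt_trans lh; apply: ae_ge0_le_integral => //.
- by apply: measurableT_comp => //; apply/measurable_EFinP; exact: measurable_normc_sqr.
- exact: measurableT_comp.
- apply: filterS fh => x hx _ /=.
  by rewrite lee_fin ger0_norm ?sqr_ge0// (le_trans hx)// ler_norm.
Qed.

Lemma L2D f g : L2 f -> L2 g -> L2 (f + g).
Proof.
move=> /L2_sqr lf /L2_sqr lg.
apply: (@L2_dom _ (fun x => 2 * (normc (f x) ^+ 2) + 2 * (normc (g x) ^+ 2))).
  exact: integrable_lincomb.
apply: filterS (L0D_ae f g) => x ->.
have := le_normcD (f x) (g x).
have := normc_ge0 (f x + g x).
move: (normc (f x + g x)) (normc (f x)) (normc (g x)) => c a b c0 cab.
have : c ^+ 2 <= (a + b) ^+ 2 by rewrite ler_sqr ?nnegrE// (le_trans c0).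
have := sqr_ge0 (a - b); nra.
Qed.

Lemma L2conj f : L2 f -> L2 (L0_conj f).
Proof.
move=> /L2_sqr lf; apply: (L2_dom lf).
by apply: filterS (L0conj_ae f) => x ->; rewrite normc_conj.
Qed.

Definition Linf : set (L0 R) :=
  [set f | exists M : R, {ae m, forall x, normc (f x) <= M}].

Lemma LinfM_L2 f g : Linf f -> L2 g -> L2 (f * g).
Proof.
move=> [M fM] /L2_sqr lg.
apply: (@L2_dom _ (fun x => M ^+ 2 * (normc (g x) ^+ 2) + 0 * (normc (g x) ^+ 2))).
  exact: integrable_lincomb.
apply: filterS2 fM (L0M_ae f g) => x fM ->.
rewrite normcM exprMn mul0r addr0 ler_wpM2r ?sqr_ge0//.
rewrite ler_sqr ?nnegrE ?normc_ge0//.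
exact: le_trans (normc_ge0 _) fM.
Qed.

Lemma Linf_cst c : Linf (L0_cst c).
Proof. by exists (normc c); apply: filterS (L0cst_ae c) => x ->. Qed.

Lemma Linf1 : Linf 1.
Proof. by rewrite -cst1; exact: Linf_cst. Qed.

Lemma LinfM f g : Linf f -> Linf g -> Linf (f * g).
Proof.
move=> [M fM] [N gN]; exists (M * N).
apply: filterS3 fM gN (L0M_ae f g) => x fM gN ->.
by rewrite normcM ler_pM// normc_ge0.
Qed.

Lemma LinfD f g : Linf f -> Linf g -> Linf (f + g).
Proof.
move=> [M fM] [N gN]; exists (M + N).
apply: filterS3 fM gN (L0D_ae f g) => x fM gN ->.
by rewrite (le_trans (le_normcD _ _))// lerD.
Qed.

Lemma Linf_conj f : Linf f -> Linf (L0_conj f).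
Proof.
move=> [M fM]; exists M; apply: filterS2 fM (L0conj_ae f) => x fM ->.
by rewrite normc_conj.
Qed.

Lemma LinfN f : Linf f -> Linf (- f).
Proof. by move=> lf; rewrite -mulN1r -cst1 -cstN; apply: LinfM => //; exact: Linf_cst.
  Qed.

Lemma unimod_Linf f : {ae m, forall x, normc (f x) = 1} -> Linf f.
Proof. by move=> f1; exists 1; apply: filterS f1 => x ->. Qed.

Lemma L2_1 : L2 (1 : L0 R).
Proof.
rewrite -cst1; apply: (@L2_dom _ (cst 1)).
  exact: finite_measure_integrable_cst.
by apply: filterS (L0cst_ae 1) => x ->; rewrite normc1 expr1n.
Qed.

Lemma Linf_sub_L2 f : Linf f -> L2 f.
Proof. by move=> lf; rewrite -[f]mulr1; apply: LinfM_L2 => //; exact: L2_1. Qed.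

Lemma L2Z c f : L2 f -> L2 (c *: f).
Proof. by move=> lf; rewrite L0_scaleE; apply: LinfM_L2 => //; exact: Linf_cst. Qed.

Lemma L2N f : L2 f -> L2 (- f).
Proof. by move=> lf; rewrite -scaleN1r; exact: L2Z. Qed.

Lemma L2B f g : L2 f -> L2 g -> L2 (f - g).
Proof. by move=> lf lg; apply: L2D => //; exact: L2N. Qed.

Lemma L2_0 : L2 (0 : L0 R).
Proof. by rewrite -(scale0r (1 : L0 R)); apply: L2Z; exact: L2_1. Qed.

Lemma L2_sub_L1 f : L2 f -> L1 f.
Proof. by move=> lf; rewrite -[f]mulr1; apply: L2M_L1 => //; exact: L2_1. Qed.

Lemma LinfM_L1 f g : Linf f -> L1 g -> L1 (f * g).
Proof.
move=> [M fM] lg.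
apply: (@L1_dom _ (fun x => M * normc (g x) + 0 * normc (g x))); first exact:
  integrable_lincomb.
apply: filterS2 fM (L0M_ae f g) => x fM ->.
by rewrite normcM mul0r addr0 ler_wpM2r ?normc_ge0.
Qed.

End AE.

(** * The Hilbert space L2 and the powers of the coordinate *)

Section Hilbert.
Variable R : realType.
Local Notation C := R[i].
Local Notation Re := (@complex.Re R).
Implicit Types (f g h u : L0 R) (c : C).
Local Notation "<| f , g |>" := (L2_dot f g) (at level 0, f, g at level 99).
Local Notation nrm := (@L2_norm R).

Lemma L2_dot_L1 f g : L2 f -> L2 g -> L1 (f * L0_conj g).
Proof. by move=> lf lg; apply: L2M_L1 => //; exact: L2conj. Qed.

Lemma dotDl f g h : L2 f -> L2 g -> L2 h -> <|f + g, h|> = <|f, h|> + <|g, h|>.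
Proof. by move=> lf lg lh; rewrite /L2_dot mulrDl cintegralD//; exact: L2_dot_L1. Qed.

Lemma dotBl f g h : L2 f -> L2 g -> L2 h -> <|f - g, h|> = <|f, h|> - <|g, h|>.
Proof. by move=> lf lg lh; rewrite /L2_dot mulrBl cintegralB//; exact: L2_dot_L1. Qed.

Lemma dotZl c f h : L2 f -> L2 h -> <|c *: f, h|> = c * <|f, h|>.
Proof. by move=> lf lh; rewrite /L2_dot L0_scaleE -mulrA -L0_scaleE cintegralZ//;
  exact: L2_dot_L1. Qed.

Lemma dotC f g : L2 f -> L2 g -> <|f, g|> = conjc <|g, f|>.
Proof.
move=> lf lg; rewrite /L2_dot -cintegral_conj; last exact: L2_dot_L1.
by rewrite L0_conjM L0_conjK mulrC.
Qed.

Lemma dotDr f g h : L2 f -> L2 g -> L2 h -> <|h, f + g|> = <|h, f|> + <|h, g|>.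
Proof. by move=> lf lg lh; rewrite /L2_dot L0_conjD mulrDr cintegralD//; exact:
  L2_dot_L1. Qed.

Lemma dotBr f g h : L2 f -> L2 g -> L2 h -> <|h, f - g|> = <|h, f|> - <|h, g|>.
Proof. by move=> lf lg lh; rewrite /L2_dot L0_conjB mulrBr cintegralB//; exact:
  L2_dot_L1. Qed.

Lemma dotZr c f h : L2 f -> L2 h -> <|h, c *: f|> = conjc c * <|h, f|>.
Proof.
move=> lf lh; rewrite /L2_dot L0_conjZ !L0_scaleE mulrCA -L0_scaleE cintegralZ//.
exact: L2_dot_L1.
Qed.

Lemma dot0l h : <|0, h|> = 0.
Proof.
by rewrite /L2_dot mul0r -[X in cintegral X](scale0r (1 : L0 R)) cintegralZ ?mul0r//;
  exact: L2_sub_L1 (L2_1 _).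
Qed.

Lemma dot0r h : <|h, 0|> = 0.
Proof.
by rewrite /L2_dot L0_conj0 mulr0 -[X in cintegral X](scale0r (1 : L0 R)) cintegralZ
  ?mul0r//; exact: L2_sub_L1 (L2_1 _).
Qed.

(** Both sides integrate the same function [u f conj g]. *)
Lemma dotMl u f g : <|u * f, g|> = <|f, L0_conj u * g|>.
Proof. by rewrite /L2_dot L0_conjM L0_conjK -mulrA mulrCA. Qed.

Lemma dot_conj f g : <|L0_conj f, L0_conj g|> = <|g, f|>.
Proof. by rewrite /L2_dot L0_conjK mulrC. Qed.

Lemma L2_sum n (F : nat -> L0 R) :
  (forall k, (k < n)%N -> L2 (F k)) -> L2 (\sum_(k < n) F k).
Proof.
elim: n => [|n IH] FL; first by rewrite big_ord0; exact: L2_0.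
rewrite big_ord_recr /=; apply: L2D; last exact: FL.
by apply: IH => k kn; apply: FL; rewrite ltnS ltnW.
Qed.

Lemma dot_suml n (F : nat -> L0 R) h : L2 h ->
  (forall k, (k < n)%N -> L2 (F k)) -> <|\sum_(k < n) F k, h|> = \sum_(k < n) <|F k, h|>.
Proof.
move=> lh; elim: n => [|n IH] FL; first by rewrite !big_ord0 dot0l.
rewrite !big_ord_recr /= dotDl// ?IH//.
- by move=> k kn; apply: FL; rewrite ltnS ltnW.
- by apply: L2_sum => k kn; apply: FL; rewrite ltnS ltnW.
- exact: FL.
Qed.

Lemma nsq_dot f : L2 f -> nsq f = Re <|f, f|>.
Proof. by move=> lf; rewrite nsqE. Qed.

Lemma nsqD f g : L2 f -> L2 g -> nsq (f + g) = nsq f + nsq g + 2 * Re <|f, g|>.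
Proof.
move=> lf lg; rewrite !nsq_dot//; last exact: L2D.
rewrite dotDl ?dotDr//; [|exact: L2D].
rewrite (dotC lg lf); case: (L2_dot f f) (L2_dot f g) (L2_dot g g) => [a b] [c d] [x y]
  /=.
by ring.
Qed.

Lemma nsqZ c f : L2 f -> nsq (c *: f) = normc c ^+ 2 * nsq f.
Proof.
move=> lf; rewrite nsq_dot; last exact: L2Z.
rewrite dotZl ?dotZr ?nsqE//; last exact: L2Z.
by rewrite normc_sqr; case: c => a b /=; ring.
Qed.

(** Positivity of the squared norm of [|g|^2 f - <f, g> g]. *)
Lemma cauchy_schwarz2 f g : L2 f -> L2 g -> normc <|f, g|> ^+ 2 <= nsq f * nsq g.
Proof.
move=> lf lg; have [g0|] := eqVneq (nsq g) 0.
  by rewrite (nsq_eq0 lg g0) dot0r normc0 expr0n/= mulr_ge0// nsq_ge0.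
move=> gn0; have gp : 0 < nsq g by rewrite lt_neqAle eq_sym gn0 nsq_ge0.
have := nsq_ge0 ((nsq g)%:C *: f + (- <|f, g|>) *: g).
rewrite nsqD ?nsqZ//; [|exact: L2Z|exact: L2Z].
rewrite dotZl ?dotZr//; [|exact: L2Z].
rewrite normcN !normc_sqr; case: (L2_dot f g) => a b /=.
rewrite !expr0n/= !addr0.
have -> : nsq g ^+ 2 * nsq f + (a ^+ 2 + b ^+ 2) * nsq g +
  2 * (nsq g * (- a * a - - - b * b) - 0 * (- a * b + - - b * a)) =
  nsq g * (nsq f * nsq g - (a ^+ 2 + b ^+ 2)) by ring.
by rewrite pmulr_rge0// subr_ge0.
Qed.

Lemma nrm_ge0 f : 0 <= nrm f.
Proof. by apply: fine_ge0; exact: Lnorm_ge0. Qed.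

Lemma nrm_sqr f : L2 f -> nrm f ^+ 2 = nsq f.
Proof. by move=> lf; rewrite L2_normE// sqr_sqrtr// nsq_ge0. Qed.

Lemma cauchy_schwarz f g : L2 f -> L2 g -> normc <|f, g|> <= nrm f * nrm g.
Proof.
move=> lf lg; rewrite -ler_sqr ?nnegrE ?normc_ge0 ?mulr_ge0 ?nrm_ge0//.
by rewrite exprMn !nrm_sqr//; exact: cauchy_schwarz2.
Qed.

Lemma nrmD f g : L2 f -> L2 g -> nrm (f + g) <= nrm f + nrm g.
Proof.
move=> lf lg; rewrite -ler_sqr ?nnegrE ?addr_ge0 ?nrm_ge0//.
rewrite sqrrD !nrm_sqr//; last exact: L2D.
rewrite nsqD//.
have : Re <|f, g|> <= nrm f * nrm g.
  exact: le_trans (ler_norm _) (le_trans (Re_normc _) (cauchy_schwarz lf lg)).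
by move: (nrm f * nrm g) (Re _) => a b; rewrite mulr2n; lra.
Qed.

Lemma nrmZ c f : L2 f -> nrm (c *: f) = normc c * nrm f.
Proof.
move=> lf; apply/eqP; rewrite -(@eqrXn2 _ 2)// ?mulr_ge0 ?nrm_ge0 ?normc_ge0//.
by rewrite exprMn !nrm_sqr ?nsqZ//; exact: L2Z.
Qed.

Lemma nrmN f : L2 f -> nrm (- f) = nrm f.
Proof. by move=> lf; rewrite -scaleN1r nrmZ// normcN normc1 mul1r. Qed.

Lemma nrmB f g : L2 f -> L2 g -> nrm (f - g) = nrm (g - f).
Proof. by move=> lf lg; rewrite -opprB nrmN//; exact: L2B. Qed.

Lemma nsq_unimod u f : u * L0_conj u = 1 -> L2 f -> L2 (u * f) -> nsq (u * f) = nsq f.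
Proof.
move=> u1 lf luf; rewrite !nsq_dot//; congr (Re _).
by rewrite dotMl mulrA (mulrC _ u) u1 mul1r.
Qed.

Lemma nrm_unimod u f : u * L0_conj u = 1 -> L2 f -> L2 (u * f) -> nrm (u * f) = nrm f.
Proof. by move=> u1 lf luf; rewrite !L2_normE// nsq_unimod. Qed.

Lemma nrm_conj f : L2 f -> nrm (L0_conj f) = nrm f.
Proof.
move=> lf; rewrite !L2_normE//; last exact: L2conj.
by rewrite !nsq_dot ?dot_conj//; exact: L2conj.
Qed.

Lemma dot_eq0 f : L2 f -> <|f, f|> = 0 -> f = 0.
Proof. by move=> lf; rewrite nsqE// => -[] /nsq_eq0; exact. Qed.

Local Notation e := (@L0_zpow R).

Lemma zpow0 : e 0 = 1. Proof. by rewrite /= expr0. Qed.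
Lemma zpow1 : e 1 = L0_z. Proof. by rewrite /= expr1. Qed.
Lemma zpowN1 : e (-1) = L0_conj L0_z. Proof. by rewrite /= expr1. Qed.

Lemma zpow_succ (n : int) : e (n + 1) = L0_z * e n.
Proof.
case: n => [n|[|n]].
- by rewrite -PoszD addn1 /= exprS.
- by rewrite /= expr0 expr1 mul_z_conj.
- have -> : Negz n.+1 + 1 = Negz n by rewrite !NegzE; lia.
  by rewrite /= [in RHS]exprS mulrA mul_z_conj mul1r.
Qed.

Lemma zpow_pred (n : int) : e (n - 1) = L0_conj L0_z * e n.
Proof. by rewrite -{2}(subrK 1 n) zpow_succ mulrA (mulrC _ L0_z) mul_z_conj mul1r. Qed.

Lemma zpowD (n k : int) : e (n + k) = e n * e k.
Proof.
elim/int_rect: n => [|n IH|n IH].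
- by rewrite add0r zpow0 mul1r.
- have -> : n.+1%:Z + k = n%:Z + k + 1 by lia.
  have -> : n.+1%:Z = n%:Z + 1 by lia.
  by rewrite !zpow_succ IH mulrA.
- have -> : - n.+1%:Z + k = - n%:Z + k - 1 by lia.
  have -> : - n.+1%:Z = - n%:Z - 1 by lia.
  by rewrite !zpow_pred IH mulrA.
Qed.

Lemma L0_conjX f n : L0_conj (f ^+ n) = L0_conj f ^+ n.
Proof. by elim: n => [|n IH]; rewrite ?expr0 ?L0_conj1// !exprS L0_conjM IH. Qed.

Lemma zpow_conj (n : int) : L0_conj (e n) = e (- n).
Proof.
case: n => [[|n]|n]; rewrite /= ?L0_conjX ?L0_conjK//.
Qed.

Lemma zpow_unit n : e n * L0_conj (e n) = 1.
Proof. by rewrite zpow_conj -zpowD subrr zpow0. Qed.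

Lemma Linf_zpow n : Linf (e n).
Proof.
have lz : Linf (L0_z : L0 R) by exact/unimod_Linf/z_unimod.
have X f : Linf f -> forall k, Linf (f ^+ k).
  by move=> lf; elim=> [|k IH]; rewrite ?expr0 ?exprS; [exact: Linf1|exact: LinfM].
by case: n => k; apply: X => //; exact: Linf_conj.
Qed.

Lemma L2_zpow n : L2 (e n).
Proof. exact/Linf_sub_L2/Linf_zpow. Qed.

Lemma L2_zpowM n f : L2 f -> L2 (e n * f).
Proof. by apply: LinfM_L2; exact: Linf_zpow. Qed.

Lemma nrm_zpowM n f : L2 f -> nrm (e n * f) = nrm f.
Proof. by move=> lf; apply: nrm_unimod => //; [exact: zpow_unit|exact: L2_zpowM]. Qed.

Lemma fourierM f k n : fourier (e k * f) n = fourier f (n - k).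
Proof. by rewrite /fourier dotMl zpow_conj -zpowD addrC. Qed.

Lemma fourierD f g n : L2 f -> L2 g -> fourier (f + g) n = fourier f n + fourier g n.
Proof. by move=> lf lg; rewrite /fourier dotDl//; exact: L2_zpow. Qed.
Lemma fourierB f g n : L2 f -> L2 g -> fourier (f - g) n = fourier f n - fourier g n.
Proof. by move=> lf lg; rewrite /fourier dotBl//; exact: L2_zpow. Qed.
Lemma fourierZ c f n : L2 f -> fourier (c *: f) n = c * fourier f n.
Proof. by move=> lf; rewrite /fourier dotZl//; exact: L2_zpow. Qed.
Lemma fourier_conj f n : L2 f -> fourier (L0_conj f) n = conjc (fourier f (- n)).
Proof.
move=> lf; rewrite /fourier -[e n]L0_conjK dot_conj zpow_conj; apply: dotC => //.
exact: L2_zpow.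
Qed.

End Hilbert.

(** * Integration on the circle and orthogonality of the powers *)

Section CircleInt.
Variable R : realType.
Local Notation C := R[i].
Local Notation m := (@circle_measure R).
Local Notation mu := (@lebesgue_measure R).
Local Notation Re := (@complex.Re R).
Local Notation Im := (@complex.Im R).
Local Notation D := (`[0, 1[%classic : set R).
Local Notation E := (@circle_exp R).
Implicit Types (f g h u : L0 R) (c : C).
Local Notation e := (@L0_zpow R).

Let mr : {measure set (measurableTypeR R) -> \bar R} := mrestr mu (measurable_itv
  `[0%R, 1%R[).

Let mrE A : mr A = mu (A `&` D). Proof. by []. Qed.

(** The measure of the circle is the image of the restriction of Lebesgue measure
    to [[0, 1[]: the complement of this interval is a null set for the restriction,
    which coincides with Lebesgue measure on its measurable subsets. *)
Lemma circle_integral_ge0 (F : circle R -> \bar R) : measurable_fun setT F ->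
  (forall x, 0 <= F x)%E -> (\int[m]_x F x = \int[mu]_(t in D) F (E t))%E.
Proof.
move=> mF F0.
have := @ge0_integral_pushforward _ _ (measurableTypeR R) (circle R) R E
  (@measurable_circle_exp R) mr setT F
  measurableT mF (fun x _ => F0 x).
move=> pf; transitivity (\int[mr]_(x in E @^-1` setT) F (E x))%E.
  rewrite -[RHS]pf; apply: eq_measure_integral => [mE|mE A mA _]; last by [].
  exact: measurable_circle_exp.
rewrite preimage_setT.
rewrite (@ge0_negligible_integral _ _ _ mr setT (~` D))//.
- rewrite setDE setCK setTI; apply: eq_measure_integral => A mA AD.
  by rewrite mrE setIidl.
- exact: measurableC.
- by rewrite mrE setICl measure0.
Qed.

Lemma circle_integral (F : circle R -> \bar R) : measurable_fun setT F ->
  (\int[m]_x F x = \int[mu]_(t in D) F (E t))%E.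
Proof.
move=> mF; rewrite integralE [RHS]integralE; congr (_ - _)%E.
  rewrite circle_integral_ge0; first by apply: eq_integral => t _; rewrite unlock.
  - exact: measurable_funepos.
  - by move=> x; exact: funepos_ge0.
rewrite circle_integral_ge0; first by apply: eq_integral => t _; rewrite unlock.
- exact: measurable_funeneg.
- by move=> x; exact: funeneg_ge0.
Qed.

Lemma circle_Rintegral (F : circle R -> R) : measurable_fun setT F ->
  \int[m]_x F x = \int[mu]_(t in D) F (E t).
Proof. by move=> mF; congr fine; apply: circle_integral; exact/measurable_EFinP. Qed.

Lemma circle_integrable (F : circle R -> R) : m.-integrable setT (EFin \o F) ->
  mu.-integrable D (EFin \o (F \o E)).
Proof.
move=> /integrableP[mF lF]; apply/integrableP; split.
  have := measurableT_comp mF (@measurable_circle_exp R).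
  exact: measurable_funTS.
by rewrite -[X in (X < _)%E](circle_integral (F := abse \o (EFin \o F)))//;
  apply: measurableT_comp.
Qed.

(** De Moivre's formula. *)
Lemma circle_expX n t : (circle_val (E t)) ^+ n =
  cos (2 * trigo.pi * (n%:R * t)) +i* sin (2 * trigo.pi * (n%:R * t)).
Proof.
elim: n => [|n IH]; first by rewrite expr0 mul0r mulr0 cos0 sin0.
have -> : 2 * trigo.pi * (n.+1%:R * t) = 2 * trigo.pi * t + 2 * trigo.pi * (n%:R * t).
  by rewrite -natr1; ring.
rewrite exprS IH /= cosD sinD.
by apply/eqP; rewrite eq_complex /=; apply/andP; split; apply/eqP; ring.
Qed.

Lemma zpow_ae n : {ae m, forall x, L0_fun (e n%:Z) x = circle_val x ^+ n}.
Proof.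
elim: n => [|n IH]; rewrite /=.
  by rewrite expr0 -cst1; apply: filterS (@L0cst_ae R 1) => x ->; rewrite expr0.
rewrite exprS; apply: filterS3 IH (L0M_ae L0_z (L0_z ^+ n)) (@L0z_ae R) => x /= h -> ->.
by rewrite h exprS.
Qed.

Lemma measurable_circle (F : circle R -> R) :
  measurable_fun setT (F \o E : measurableTypeR R -> R) -> measurable_fun setT F.
Proof. by move=> mF _ B mB; rewrite setTI; have := mF measurableT B mB; rewrite setTI.
  Qed.

Lemma measurable_circleX n : measurable_fun setT (fun x : circle R => Re (circle_val x
  ^+ n)) /\
  measurable_fun setT (fun x : circle R => Im (circle_val x ^+ n)).
Proof.
have cl : continuous (fun t : R => 2 * trigo.pi * (n%:R * t)).
  by move=> x; apply: cvgMr; apply: cvgMr; exact: cvg_id.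
split; apply: measurable_circle; rewrite /comp /=.
- under eq_fun do rewrite circle_expX /=.
  apply: continuous_measurable_fun => x.
  apply: (@continuous_comp _ _ _ (fun t : R => 2 * trigo.pi * (n%:R * t)) (@cos R));
    [exact: cl|exact: continuous_cos].
- under eq_fun do rewrite circle_expX /=.
  apply: continuous_measurable_fun => x.
  apply: (@continuous_comp _ _ _ (fun t : R => 2 * trigo.pi * (n%:R * t)) (@sin R));
    [exact: cl|exact: continuous_sin].
Qed.

Lemma cos_2pin n : cos (2 * trigo.pi * n%:R) = 1 :> R.
Proof.
have := circle_expX n 1.
rewrite /= mulr1 mulr_natl cos2pi sin2pi expr1n mulr1.
by move=> /eqP; rewrite eq_complex/= => /andP[/eqP <-].
Qed.
Lemma sin_2pin n : sin (2 * trigo.pi * n%:R) = 0 :> R.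
Proof.
have := circle_expX n 1.
rewrite /= mulr1 mulr_natl cos2pi sin2pi expr1n mulr1.
by move=> /eqP; rewrite eq_complex/= => /andP[_ /eqP <-].
Qed.

Lemma Rintegral_periodic_derivative (f F : R -> R) : continuous f -> (forall x : R,
  is_derive x 1 F (f x)) ->
  F 1 = F 0 -> \int[mu]_(t in D) f t = 0.
Proof.
move=> cf dF F10.
have If : mu.-integrable `[0, 1] (EFin \o f).
  apply: continuous_compact_integrable; first exact: segment_compact.
  exact: continuous_subspaceT.
have cF : continuous F.
  move=> x; apply: differentiable_continuous; apply/derivable1_diffP.
  by have [] := dF x.
rewrite Rintegral_itv_bndo_bndc; last first.
  by apply: integrableS If => //; apply: subset_itvl; rewrite bnd_simp.
rewrite /Rintegral (@continuous_FTC2 _ _ F)//.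
- by rewrite F10 /= subrr.
- exact: continuous_subspaceT.
- split; first by move=> x _; have [] := dF x.
    exact/cvg_at_right_filter/cF.
  exact/cvg_at_left_filter/cF.
- by move=> x _; rewrite derive1E; have [_ ->] := dF x.
Qed.

Lemma is_derive_lin (w x : R) : is_derive x 1 (fun t : R => w * t) w.
Proof.
rewrite (_ : (fun t : R => w * t) = w \*: (id : R -> R))//.
by rewrite -[X in is_derive _ _ _ X]mulr1; exact: is_deriveZ.
Qed.

Lemma Rintegral_cos_sin n :
  \int[mu]_(t in D) cos (2 * trigo.pi * (n.+1%:R * t)) = 0 /\
  \int[mu]_(t in D) sin (2 * trigo.pi * (n.+1%:R * t)) = 0.
Proof.
pose w : R := 2 * trigo.pi * n.+1%:R.
have w0 : w != 0 by rewrite mulf_neq0 ?mulf_neq0 ?pnatr_eq0// gt_eqF// pi_gt0.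
have cl : continuous (fun t : R => w * t) by move=> x; apply: cvgMr; exact: cvg_id.
have E1 t : 2 * trigo.pi * (n.+1%:R * t) = w * t by rewrite /w mulrA.
split.
- under eq_Rintegral do rewrite E1.
  apply: (@Rintegral_periodic_derivative (cos \o (fun t => w * t)) (fun t => w^-1 *
    (sin \o (fun t => w * t)) t)).
  + by move=> x; apply: continuous_comp; [exact: cl|exact: continuous_cos].
  + move=> x.
    have h := is_derive1_comp (is_derive_sin (w * x)) (is_derive_lin w x).
    have := @is_deriveZ _ _ _ _ w^-1 _ _ _ h.
    rewrite [X in is_derive _ _ _ X -> _](_ : _ = cos (w * x))//.
    by rewrite /GRing.scale/= mulrCA mulVf// mulr1.
  + by rewrite /= mulr1 mulr0 sin0 /w sin_2pin.
- under eq_Rintegral do rewrite E1.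
  apply: (@Rintegral_periodic_derivative (sin \o (fun t => w * t)) (fun t => (- w^-1) *
    (cos \o (fun t => w * t)) t)).
  + by move=> x; apply: continuous_comp; [exact: cl|exact: continuous_sin].
  + move=> x.
    have h := is_derive1_comp (is_derive_cos (w * x)) (is_derive_lin w x).
    have := @is_deriveZ _ _ _ _ (- w^-1) _ _ _ h.
    rewrite [X in is_derive _ _ _ X -> _](_ : _ = sin (w * x))//.
    by rewrite /GRing.scale/= !mulNr mulrN opprK mulrCA mulVf// mulr1.
  + by rewrite /= mulr1 mulr0 cos0 /w cos_2pin.
Qed.

Lemma cintegral_zpow_pos n : cintegral (e n.+1%:Z) = 0.
Proof.
have h := zpow_ae n.+1; have [mR mI] := measurable_circleX n.+1.
have [iR iI] := Rintegral_cos_sin n.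
apply/eqP; rewrite eq_complex/=; apply/andP; split; apply/eqP.
  rewrite (@ae_eq_Rintegral _ _ (fun x => Re (circle_val x ^+ n.+1)))//; last 2 first.
  - exact: measurable_Re.
  - by apply: filterS h => x ->.
  by rewrite circle_Rintegral//; under eq_Rintegral do rewrite circle_expX/=.
rewrite (@ae_eq_Rintegral _ _ (fun x => Im (circle_val x ^+ n.+1)))//; last 2 first.
- exact: measurable_Im.
- by apply: filterS h => x ->.
by rewrite circle_Rintegral//; under eq_Rintegral do rewrite circle_expX/=.
Qed.

Lemma cintegral1 : cintegral (1 : L0 R) = 1.
Proof.
rewrite -cst1; have h := @L0cst_ae R 1.
apply/eqP; rewrite eq_complex/=; apply/andP; split; apply/eqP.
  rewrite (@ae_eq_Rintegral _ _ (cst 1))//; last 2 first.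
  - exact: measurable_Re.
  - by apply: filterS h => x ->.
  by rewrite Rintegral_cst// mul1r [X in fine X]probability_setT.
rewrite (@ae_eq_Rintegral _ _ (cst 0))//; last 2 first.
- exact: measurable_Im.
- by apply: filterS h => x ->.
by rewrite Rintegral_cst// mul0r.
Qed.

Lemma cintegral_zpow (n : int) : cintegral (e n) = (n == 0)%:R.
Proof.
case: n => [[|n]|n].
- by rewrite zpow0 cintegral1.
- exact: cintegral_zpow_pos.
- have -> : e (Negz n) = L0_conj (e n.+1%:Z) by rewrite zpow_conj NegzE.
  rewrite cintegral_conj ?cintegral_zpow_pos ?conjc0//.
  by apply: L2_sub_L1; exact: L2_zpow.
Qed.

Lemma fourier_zpow (n k : int) : fourier (e n) k = (n == k)%:R.
Proof. by rewrite /fourier /L2_dot zpow_conj -zpowD cintegral_zpow subr_eq0. Qed.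

End CircleInt.

(** * Polynomial approximation of a step *)

Section Bump.
Variable R : realType.
Implicit Types (x y : R).

Lemma bernoulli_ge1 n x : 0 <= x -> 1 + n%:R * x <= (1 + x) ^+ n.
Proof.
move=> x0; elim: n => [|n IH]; first by rewrite mul0r addr0 expr0.
rewrite exprS.
have : (1 + x) * (1 + n%:R * x) <= (1 + x) * (1 + x) ^+ n.
  by rewrite ler_wpM2l// addr_ge0.
apply: le_trans.
rewrite -natr1 mulrDl mul1r; have : 0 <= n%:R * x * x by rewrite !mulr_ge0.
by move: (n%:R : R) => k; nra.
Qed.

Lemma bernoulli_le1 n x : 0 <= x <= 1 -> 1 - n%:R * x <= (1 - x) ^+ n.
Proof.
move=> /andP[x0 x1]; elim: n => [|n IH]; first by rewrite mul0r subr0 expr0.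
rewrite exprS.
have : (1 - x) * (1 - n%:R * x) <= (1 - x) * (1 - x) ^+ n.
  by rewrite ler_wpM2l// subr_ge0.
apply: le_trans.
rewrite -natr1 mulrDl mul1r; have : 0 <= n%:R * x * x by rewrite !mulr_ge0.
by move: (n%:R : R) => k; nra.
Qed.

(** The polynomials of the Brosowski-Deutsch proof of the Stone-Weierstrass
    theorem: on [[0, 1]] they tend boundedly to 1 below [1/2] and to 0 above. *)
Definition bump n x : R := (1 - x ^+ n) ^+ (2 ^ n).

Lemma bump_ge0 n x : 0 <= x <= 1 -> 0 <= bump n x.
Proof. by move=> /andP[x0 x1]; rewrite /bump exprn_ge0// subr_ge0 exprn_ile1. Qed.

Lemma bump_le1 n x : 0 <= x <= 1 -> bump n x <= 1.
Proof.
move=> /andP[x0 x1]; rewrite /bump exprn_ile1//.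
  by rewrite subr_ge0 exprn_ile1.
by rewrite lerBlDr lerDl exprn_ge0.
Qed.

(** Bernoulli's inequality bounds [bump n x] below by [1 - (2 x)^n]. *)
Lemma bump_cvg1 x : 0 <= x < 2^-1 -> bump ^~ x @ \oo --> (1 : R).
Proof.
move=> /andP[x0 x2].
have x1 : x <= 1 by lra.
apply: (@squeeze_cvgr _ _ _ _ (fun n => 1 - (2 * x) ^+ n) (fun=> 1)).
- near=> n; rewrite bump_le1 ?x0// andbT.
  rewrite /bump exprMn -natrX; apply: bernoulli_le1.
  by rewrite exprn_ge0// exprn_ile1.
- rewrite -[X in _ --> X](subr0 1); apply: cvgB; first exact: cvg_cst.
  by apply: cvg_expr; rewrite ger0_norm; lra.
- exact: cvg_cst.
Unshelve. all: by end_near. Qed.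

(** As [(1 - y) (1 + y) <= 1], [bump n x] is at most the inverse of
    [(1 + x^n)^(2^n)], which Bernoulli's inequality bounds below by [(2 x)^n]. *)
Lemma bump_cvg0 x : 2^-1 < x <= 1 -> bump ^~ x @ \oo --> (0 : R).
Proof.
move=> /andP[x2 x1].
have x0 : 0 <= x by lra.
apply: (@squeeze_cvgr _ _ _ _ (fun=> 0) (fun n => ((2 * x)^-1) ^+ n)).
- near=> n; rewrite bump_ge0 ?x0//=.
  have p0 : 0 < (2 * x) ^+ n by rewrite exprn_gt0//; lra.
  rewrite exprVn -[X in _ <= X]mul1r ler_pdivlMr//.
  have h : bump n x * (1 + x ^+ n) ^+ (2 ^ n) <= 1.
    rewrite /bump -exprMn exprn_ile1//.
    - by apply: mulr_ge0; [rewrite subr_ge0 exprn_ile1|rewrite addr_ge0 ?exprn_ge0].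
    - have : 0 <= x ^+ n by rewrite exprn_ge0.
      by move: (x ^+ n) => y y0; nra.
  apply: le_trans h; rewrite ler_wpM2l// ?bump_ge0 ?x0//.
  apply: le_trans (bernoulli_ge1 _ (exprn_ge0 n x0)).
  by rewrite exprMn natrX lerDr.
- exact: cvg_cst.
- apply: cvg_expr; rewrite ger0_norm ?invr_ge0; last lra.
  by rewrite invf_lt1; lra.
Unshelve. all: by end_near. Qed.

End Bump.

(** * Integrals over intervals *)

Section RealLine.
Variable R : realType.
Local Notation mu := (@lebesgue_measure R).
Local Notation D := (`[0, 1[%classic : set R).

(** This is the trigonometric polynomial [1/2 - (cos (2 pi t - pi b) - cos (pi b)) / 4]
    of the variable [2 pi t]; its factored form shows that on [[0, 1[] it is below
    [1/2] exactly on [ ]0, b[ ]. *)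
Definition dip (b t : R) : R :=
  2^-1 - 2^-1 * (sin (trigo.pi * t) * sin (trigo.pi * (b - t))).

Lemma dip01 b t : 0 <= dip b t <= 1.
Proof.
have := sin_le1 (trigo.pi * t); have := sin_geN1 (trigo.pi * t).
have := sin_le1 (trigo.pi * (b - t)); have := sin_geN1 (trigo.pi * (b - t)).
rewrite /dip; move: (sin _) (sin _) => x y; nra.
Qed.

Lemma dip_in b t : 0 < t < b -> b < 1 -> dip b t < 2^-1.
Proof.
move=> /andP[t0 tb] b1; have p0 := pi_gt0 R.
have : 0 < sin (trigo.pi * t) by apply: sin_gt0_pi; nra.
have : 0 < sin (trigo.pi * (b - t)) by apply: sin_gt0_pi; nra.
rewrite /dip; move: (sin _) (sin _) => x y; nra.
Qed.

Lemma dip_out b t : 0 < b < t -> t < 1 -> 2^-1 < dip b t.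
Proof.
move=> /andP[b0 bt] t1; have p0 := pi_gt0 R.
have : 0 < sin (trigo.pi * t) by apply: sin_gt0_pi; nra.
have : 0 < sin (trigo.pi * (t - b)) by apply: sin_gt0_pi; nra.
rewrite /dip -[b - t]opprB mulrN sinN; move: (sin _) (sin _) => x y; nra.
Qed.

Lemma measurable_dip b : measurable_fun setT (dip b).
Proof.
apply: continuous_measurable_fun => t.
apply: cvgB; first exact: cvg_cst.
apply: cvgMr; apply: cvgM.
- apply: (@continuous_comp _ _ _ (fun t : R => trigo.pi * t) (@sin R)).
    by apply: cvgMr; exact: cvg_id.
  exact: continuous_sin.
- apply: (@continuous_comp _ _ _ (fun t : R => trigo.pi * (b - t)) (@sin R)).
    by apply: cvgMr; apply: cvgB; [exact: cvg_cst|exact: cvg_id].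
  exact: continuous_sin.
Qed.

(** Dominated convergence: [bump n (dip b t)] tends boundedly to the indicator of
    [ ]0, b[ ], except at the points 0 and [b]. *)
Lemma bump_integral0 (h : R -> R) (b : R) : 0 < b < 1 ->
  mu.-integrable D (EFin \o h) ->
  (forall n, \int[mu]_(t in D) (h t * bump n (dip b t)) = 0) ->
  \int[mu]_(t in `]0, b[) h t = 0.
Proof.
move=> /andP[b0 b1] ih h0.
have mh : measurable_fun D h by apply/measurable_EFinP; exact: measurable_int ih.
have mb n : measurable_fun D (fun t => bump n (dip b t)).
  apply: measurable_funTS; apply: measurable_funX; apply: measurable_funB => //.
  by apply: measurable_funX; exact: measurable_dip.
have mO : measurable (`]0, b[%classic : set R) by exact: measurable_itv.
have sub : `]0, b[%classic `<=` D.
  by move=> t /=; rewrite !in_itv/= => /andP[t0 tb]; rewrite (ltW t0) (lt_trans tb).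
have mD : measurable D by exact: measurable_itv.
pose G : R -> R := h \_ (`]0, b[%classic : set R).
have [_ _ cv] : [/\ mu.-integrable D (EFin \o G),
   [sequence \int[mu]_(t in D) `|(h t * bump n (dip b t))%:E - (EFin \o G) t|]_n @ \oo
     --> 0 &
   [sequence \int[mu]_(t in D) (h t * bump n (dip b t))%:E]_n @ \oo -->
     \int[mu]_(t in D) (EFin \o G) t]%E.
  apply: (@dominated_convergence _ _ _ mu D mD
    (fun n t => (h t * bump n (dip b t))%:E) _ (abse \o (EFin \o h))).
  - by move=> n; apply/measurable_EFinP; by apply: measurable_funM => //; exact: mb.
  - apply/measurable_EFinP; apply/(measurable_restrict _ mO mD).
    apply: measurable_funS mh => //; exact: subIsetr.
  - exists [set 0; b]; split => //.
      by apply: measurableU; exact: measurable_set1.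
      by rewrite measureU0//; exact: lebesgue_measure_set1.
    move=> t /=; apply: contra_notP => /not_orP[t0 tb].
    rewrite in_itv/= => /andP[t0' t1].
    have {t0 t0'} t0 : 0 < t by rewrite lt_neqAle t0' andbT; apply/eqP => /esym.
    apply: cvg_EFin; first by near=> n.
    rewrite /comp /= /G; have [tb'|bt] := ltP t b.
      rewrite patchE mem_set; last by rewrite /= in_itv/= t0.
      rewrite -[X in _ --> X]mulr1; apply: cvgMr; apply: bump_cvg1.
      by have /andP[-> _] := dip01 b t; rewrite dip_in// t0.
    rewrite patchE memNset; last by rewrite /= in_itv/= t0/= => /(le_lt_trans bt);
      rewrite ltxx.
    rewrite -[X in _ --> X](mulr0 (h t)); apply: cvgMr; apply: bump_cvg0.
    have /andP[_ ->] := dip01 b t; rewrite dip_out// b0/= lt_neqAle bt andbT.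
    by apply/eqP => /esym.
  - exact: integrable_abse.
  - apply: aeW => t n _ /=; rewrite lee_fin normrM [X in _ * X]ger0_norm ?bump_ge0
    ?dip01//.
    by rewrite -[leRHS]mulr1 ler_wpM2l// bump_le1// dip01.
have : (fun n => \int[mu]_(t in D) (h t * bump n (dip b t))%:E)%E = (fun=> 0%E).
  apply/funext => n; have := h0 n; rewrite /Rintegral => h0n.
  rewrite -[LHS]fineK ?h0n//; apply: integrable_fin_num => //.
  apply: (@le_integrable _ _ _ mu D mD _ (EFin \o h)) => //.
    by apply/measurable_EFinP; by apply: measurable_funM => //; exact: mb.
  move=> t _ /=; rewrite lee_fin normrM [X in _ * X]ger0_norm ?bump_ge0 ?dip01//.
  by rewrite -[leRHS]mulr1 ler_wpM2l// bump_le1// dip01.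
move=> e0; rewrite e0 in cv.
have {}cv := cvg_unique _ cv (cvg_cst _).
rewrite -(setIidr sub) Rintegral_mkcondr /Rintegral.
by rewrite [X in fine X](cv (@ereal_hausdorff R)).
Unshelve. all: by end_near. Qed.

(** By the Lebesgue differentiation theorem [h] is almost everywhere the
    derivative of its primitive from 0, and this primitive vanishes. *)
Lemma integral0_ae (h : R -> R) : mu.-integrable D (EFin \o h) ->
  (forall b, 0 < b < 1 -> \int[mu]_(t in `]0, b[) h t = 0) ->
  {ae mu, forall t, D t -> h t = 0}.
Proof.
move=> ih h0.
have mD : measurable D by exact: measurable_itv.
pose k := h \_ D.
have ik : mu.-integrable setT (EFin \o k).
  by rewrite /k -restrict_EFin; apply/integrable_restrict => //; rewrite setTI.
have lk : locally_integrable setT k by exact: integrable_locally_restrict.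
have F0 y : 0 < y < 1 -> \int[mu]_(t in `]0, y]) k t = 0.
  move=> /andP[y0 y1].
  rewrite -Rintegral_itv_bndo_bndc; last first.
    by apply: integrableS ik => //; exact: measurable_itv.
  rewrite -[RHS](h0 y) ?y0//; apply: eq_Rintegral => t.
  rewrite inE /= in_itv/= => /andP[t0 ty].
  by rewrite /k patchE mem_set//= in_itv/= (ltW t0) (lt_trans ty).
have := @FTC1 R k (BRight 0) _ lk.
have ik' y : mu.-integrable [set` Interval (BRight 0) (BRight y)] (EFin \o k).
  by apply: integrableS ik => //; exact: measurable_itv.
move=> /(_ ik') dk.
have n0 : {ae mu, forall t : R, t != 0}.
  exists [set 0]; split; [exact: measurable_set1|exact: lebesgue_measure_set1|].
  by move=> t /= /negP; rewrite negbK => /eqP.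
have FF := ae_filter_ringOfSetsType mu.
apply: (@filterS2 _ _ FF _ _ _ _ dk n0) => t {}dk tn0; rewrite /= in_itv/= => /andP[t0
  t1].
have {}t0 : 0 < t by rewrite lt_neqAle eq_sym tn0.
have [_] := dk t0.
rewrite /k patchE mem_set/=; last by rewrite in_itv/= (ltW t0).
move=> <-; rewrite derive1E; apply/cvg_lim => //.
apply: cvg_near_cst; near=> d.
rewrite /= (F0 t) ?t0// F0 ?subrr ?scaler0//.
rewrite [_%:A]mulr1 addrC; apply/andP; split.
  rewrite -ltrBlDl sub0r.
  have : `|d| < t by near: d; apply: dnbhs0_lt.
  by rewrite ltr_norml => /andP[].
rewrite -ltrBrDl.
have : `|d| < 1 - t by near: d; apply: dnbhs0_lt; rewrite subr_gt0.
by rewrite ltr_norml => /andP[].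
Unshelve. all: by end_near. Qed.

End RealLine.

(** * Uniqueness of Fourier coefficients *)

Section Uniqueness.
Variable R : realType.
Local Notation C := R[i].
Local Notation m := (@circle_measure R).
Local Notation mu := (@lebesgue_measure R).
Local Notation Re := (@complex.Re R).
Local Notation Im := (@complex.Im R).
Local Notation D := (`[0, 1[%classic : set R).
Local Notation E := (@circle_exp R).
Implicit Types (f g h u q : L0 R) (c : C).
Local Notation e := (@L0_zpow R).

Definition annihilated g := forall n, cintegral (g * e n) = 0.

(** These multipliers form a ring that contains the constants and the powers of
    the coordinate, hence all trigonometric polynomials; this spares the expansion
    of the bumps into monomials. *)
Definition annih_mult q := Linf q /\
  forall g, L1 g -> annihilated g -> annihilated (q * g).

Lemma annih_cst c : annih_mult (L0_cst c).
Proof.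
split=> [|g lg g0 n]; first exact: Linf_cst.
rewrite -mulrA -L0_scaleE cintegralZ ?g0 ?mulr0// mulrC.
by apply: LinfM_L1 => //; exact: Linf_zpow.
Qed.

Lemma annih_zpow k : annih_mult (e k).
Proof.
split=> [|g lg g0 n]; first exact: Linf_zpow.
by rewrite mulrAC -zpowD mulrC g0.
Qed.

Lemma annihM p q : annih_mult p -> annih_mult q -> annih_mult (p * q).
Proof.
move=> [lp ap] [lq aq]; split=> [|g lg g0]; first exact: LinfM.
by rewrite -mulrA; apply: ap; [exact: LinfM_L1|exact: aq].
Qed.

Lemma annihD p q : annih_mult p -> annih_mult q -> annih_mult (p + q).
Proof.
move=> [lp ap] [lq aq]; split=> [|g lg g0 n]; first exact: LinfD.
rewrite !mulrDl cintegralD; first by rewrite ap// aq// addr0.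
  by rewrite mulrC; apply: LinfM_L1; [exact: Linf_zpow|exact: LinfM_L1].
by rewrite mulrC; apply: LinfM_L1; [exact: Linf_zpow|exact: LinfM_L1].
Qed.

Lemma annihN p : annih_mult p -> annih_mult (- p).
Proof. by move=> ap; rewrite -mulN1r -cst1 -cstN; apply: annihM => //; exact:
  annih_cst. Qed.

Lemma annihX p n : annih_mult p -> annih_mult (p ^+ n).
Proof.
move=> ap; elim: n => [|n IH]; first by rewrite expr0 -cst1; exact: annih_cst.
by rewrite exprS; exact: annihM.
Qed.

Lemma L0X_ae f n : {ae m, forall x, L0_fun (f ^+ n) x = f x ^+ n}.
Proof.
elim: n => [|n IH].
  by rewrite expr0 -cst1; apply: filterS (@L0cst_ae R 1) => x ->; rewrite expr0.
rewrite exprS; apply: filterS2 IH (L0M_ae f (f ^+ n)) => x h ->.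
by rewrite h exprS.
Qed.

(** With this coefficient [c], the function [(cos (2 pi t - pi b)) / 4] is
    [c z + conj c conj z] at [z = exp (2 i pi t)]. *)
Definition dip_coef (b : R) : C := (cos (trigo.pi * b) / 8) -i* (sin (trigo.pi * b) / 8).

Definition dip_poly (b : R) : L0 R :=
  L0_cst (2^-1 + cos (trigo.pi * b) / 4)%:C +
  - (L0_cst (dip_coef b) * e 1 + L0_cst (conjc (dip_coef b)) * e (-1)).

Definition dip_circle (b : R) (x : circle R) : R :=
  2^-1 + cos (trigo.pi * b) / 4 -
  (cos (trigo.pi * b) * Re x + sin (trigo.pi * b) * Im x) / 4.

Lemma dip_poly_ae b : {ae m, forall x, dip_poly b x = (dip_circle b x)%:C}.
Proof.
near=> x.
rewrite /dip_poly (near (L0D_ae _ _) x)// (near (L0N_ae _) x)//.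
rewrite (near (L0D_ae (L0_cst (dip_coef b) * e 1) _) x)//.
rewrite (near (L0M_ae (L0_cst (dip_coef b)) (e 1)) x)//.
rewrite (near (L0M_ae (L0_cst (conjc (dip_coef b))) (e (-1))) x)//.
rewrite zpow1 zpowN1 (near (L0conj_ae L0_z) x)// (near (@L0z_ae R) x)//.
rewrite (near (L0cst_ae (dip_coef b)) x)//.
rewrite (near (L0cst_ae (conjc (dip_coef b))) x)//.
rewrite (near (L0cst_ae (2^-1 + cos (trigo.pi * b) / 4)%:C) x)//.
rewrite /dip_circle /dip_coef; case: (circle_val x) => u v /=.
by apply/eqP; rewrite eq_complex /=; apply/andP; split; apply/eqP; field.
Unshelve. all: by end_near. Qed.

Lemma dip_circleE b t : dip_circle b (E t) = dip b t.
Proof.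
rewrite /dip_circle /dip /= (_ : 2 * trigo.pi * t = (trigo.pi * t) *+ 2); last by ring.
rewrite mulr2n cosD sinD (mulrBr trigo.pi b t) sinB.
have := cos2Dsin2 (trigo.pi * t).
move: (cos (trigo.pi * t)) (sin (trigo.pi * t)) (cos (trigo.pi * b)) (sin (trigo.pi * b)).
move=> c s B S h.
have -> : c * c = 1 - s * s by rewrite -h !expr2 addrK.
by field.
Qed.

Lemma measurable_dip_circle b : measurable_fun setT (dip_circle b).
Proof.
apply: measurable_circle; rewrite (_ : _ \o _ = dip b); first exact: measurable_dip.
by apply/funext => t /=; rewrite dip_circleE.
Qed.

Lemma bump_poly_ae b n :
  {ae m, forall x, L0_fun ((1 + - dip_poly b ^+ n) ^+ (2 ^ n)) x = (bump n (dip_circle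
    b x))%:C}.
Proof.
near=> x.
rewrite (near (L0X_ae (1 + - dip_poly b ^+ n) (2 ^ n)) x)//.
rewrite (near (L0D_ae 1 (- dip_poly b ^+ n)) x)//.
rewrite (near (L0N_ae (dip_poly b ^+ n)) x)//.
rewrite (near (L0X_ae (dip_poly b) n) x)//.
rewrite (near (dip_poly_ae b) x)// -cst1 (near (L0cst_ae 1) x)//.
have X (r : R) k : r%:C ^+ k = (r ^+ k)%:C.
  elim: k => [|k IH]; first by rewrite !expr0.
  rewrite !exprS IH; apply/eqP; rewrite eq_complex /=.
  by apply/andP; split; apply/eqP; ring.
rewrite /bump X -[RHS]X; congr (_ ^+ _).
by apply/eqP; rewrite eq_complex /= subrr !eqxx.
Unshelve. all: by end_near. Qed.

Lemma circle_ae (F : circle R -> R) : measurable_fun setT F ->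
  {ae mu, forall t, D t -> F (E t) = 0} -> {ae m, forall x, F x = 0}.
Proof.
move=> mF [N [mN N0 sN]].
have mA : measurable (F @^-1` [set~ 0]).
  rewrite -[X in measurable X]setTI; apply: mF => //.
  by apply: measurableC; exact: measurable_set1.
exists (F @^-1` [set~ 0]); split => //.
change (mu (E @^-1` (F @^-1` [set~ 0]) `&` D) = 0%E).
apply: (subset_measure0 _ mN _ N0).
- apply: measurableI; last exact: measurable_itv.
  by have := @measurable_circle_exp R measurableT _ mA; rewrite setTI.
- move=> t [/= Ft Dt]; apply: sN => /= h; exact/Ft/h.
Qed.

(** The integrals of [f] against all the bumps vanish. The bumps are real, so the
    same holds for the real and for the imaginary part of [f], and both vanish by
    [bump_integral0] and [integral0_ae]. *)
Lemma fourier_unique_L1 f : L1 f -> annihilated f -> f = 0.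
Proof.
move=> lf f0.
have key (G : circle R -> R) : measurable_fun setT G ->
    m.-integrable setT (EFin \o G) ->
    (forall b n, \int[m]_x (G x * bump n (dip_circle b x)) = 0) ->
    {ae m, forall x, G x = 0}.
  move=> mG iG G0; apply: circle_ae => //.
  apply: (integral0_ae (h := G \o E)); first exact: circle_integrable.
  move=> b b01; apply: bump_integral0 => //; first exact: circle_integrable.
  move=> n; rewrite -[RHS](G0 b n) circle_Rintegral.
    by apply: eq_Rintegral => t _; rewrite dip_circleE.
  apply: measurable_funM => //; apply: measurable_funX; apply: measurable_funB => //.
  by apply: measurable_funX; exact: measurable_dip_circle.
have mb b n : measurable_fun setT (fun x => bump n (dip_circle b x)).
  apply: measurable_funX; apply: measurable_funB => //.
  by apply: measurable_funX; exact: measurable_dip_circle.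
have q0 b n : cintegral (((1 + - dip_poly b ^+ n) ^+ (2 ^ n)) * f) = 0.
  have [_ /(_ f lf f0 0)] : annih_mult ((1 + - dip_poly b ^+ n) ^+ (2 ^ n)).
    apply: annihX; apply: annihD; first by rewrite -cst1; exact: annih_cst.
    apply: annihN; apply: annihX; apply: annihD; first exact: annih_cst.
    by apply: annihN; apply: annihD; apply: annihM;
      [exact: annih_cst|exact: annih_zpow|exact: annih_cst|exact: annih_zpow].
  by rewrite zpow0 mulr1.
have v b n : {ae m, forall x, L0_fun (((1 + - dip_poly b ^+ n) ^+ (2 ^ n)) * f) x =
    (bump n (dip_circle b x))%:C * f x}.
  apply: filterS2 (L0M_ae ((1 + - dip_poly b ^+ n) ^+ (2 ^ n)) f) (bump_poly_ae b n).
  by move=> x -> ->.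
have hR : {ae m, forall x, Re (f x) = 0}.
  apply: key; [exact: measurable_Re|exact: L1_Re|move=> b n].
  have := q0 b n => /eqP; rewrite eq_complex => /andP[/eqP/= <- _].
  apply: ae_eq_Rintegral; [apply: measurable_funM => //; exact: measurable_Re|exact:
    measurable_Re|].
  by apply: filterS (v b n) => x ->; case: (f x) => p q /=; ring.
have hI : {ae m, forall x, Im (f x) = 0}.
  apply: key; [exact: measurable_Im|exact: L1_Im|move=> b n].
  have := q0 b n => /eqP; rewrite eq_complex => /andP[_ /eqP/= <-].
  apply: ae_eq_Rintegral; [apply: measurable_funM => //; exact: measurable_Im|exact:
    measurable_Im|].
  by apply: filterS (v b n) => x ->; case: (f x) => p q /=; ring.
rewrite -cst0; apply: L0_ext.
by apply: filterS3 hR hI (L0cst_ae 0) => x; case: (f x) => p q /= -> -> ->.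
Qed.

Lemma fourier_unique f : L2 f -> (forall n, fourier f n = 0) -> f = 0.
Proof.
move=> lf f0; apply: fourier_unique_L1; first exact: L2_sub_L1.
by move=> n; have := f0 (- n); rewrite /fourier /L2_dot zpow_conj opprK.
Qed.

End Uniqueness.

(** * Completeness of L2 *)

Lemma series_cvg (R : realType) (v : R^nat) (d : nat -> R) :
  (forall k, `|v k.+1 - v k| <= d k) -> (\sum_(k <oo) (d k)%:E < +oo)%E -> cvgn v.
Proof.
move=> vd dlty.
have d0 k : 0 <= d k by exact: le_trans (normr_ge0 _) (vd k).
have cs : cvgn (series (telescope v)).
  apply: normed_cvg; apply: nondecreasing_is_cvgn.
    by apply/nondecreasing_seqP => n; rewrite /= !seriesEnat/= big_nat_recr//= lerDl.
  exists (fine (\sum_(k <oo) (d k)%:E)) => _ [n _ <-] /=.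
  rewrite -lee_fin fineK; last first.
    by rewrite ge0_fin_numE// nneseries_ge0// => k _ _; rewrite lee_fin.
  apply: (@le_trans _ _ (\sum_(0 <= k < n) (d k)%:E)%E).
    by rewrite sumEFin lee_fin; apply: ler_sum => k _; exact: vd.
  by apply: nneseries_lim_ge => k _ _; rewrite lee_fin.
have -> : v = (fun n => v 0%N + series (telescope v) n).
  by apply/funext => n; exact: eq_sum_telescope.
apply: is_cvgD => //; exact: is_cvg_cst.
Qed.

Section Completeness.
Variable R : realType.
Local Notation C := R[i].
Local Notation m := (@circle_measure R).
Local Notation Re := (@complex.Re R).
Local Notation Im := (@complex.Im R).
Implicit Types (f g h u q : L0 R) (c : C).
Local Notation nrm := (@L2_norm R).

(** Integrate [2 eps |f| <= |f|^2 + eps^2]; the total mass is 1. *)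
Lemma integral_normc_le f (eps : R) : 0 < eps -> L2 f -> nrm f <= eps ->
  (\int[m]_x (normc (f x))%:E <= eps%:E)%E.
Proof.
move=> e0 lf fe; have l1 := L2_sub_L1 lf; have /L2_sqr l2 := lf.
rewrite -(fineK (integrable_fin_num measurableT l1)) lee_fin.
have ic : m.-integrable setT (EFin \o (cst (1 : R))) by exact:
  finite_measure_integrable_cst.
have : \int[m]_x normc (f x) <=
    \int[m]_x ((2 * eps)^-1 * (normc (f x) ^+ 2) + (eps / 2) * 1).
  apply: le_Rintegral => //; first exact: (integrable_lincomb l2 ic).
  move=> x _; rewrite mulr1 -(ler_pM2l (_ : 0 < 2 * eps)); last by rewrite mulr_gt0.
  rewrite mulrDr mulrA mulfV ?mul1r; last by rewrite mulf_neq0// gt_eqF.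
  have := sqr_ge0 (normc (f x) - eps).
  have -> : 2 * eps * (eps / 2) = eps ^+ 2 by field.
  by move: (normc (f x)) => a; nra.
move=> /le_trans; apply; rewrite (Rintegral_lincomb l2 ic).
rewrite -/(nsq f) -nrm_sqr// Rintegral_cst// mul1r.
rewrite [fine _](_ : _ = 1); last by rewrite -[RHS]/(fine 1%E) -(probability_setT m).
have : nrm f ^+ 2 <= eps ^+ 2 by rewrite ler_sqr ?nnegrE ?nrm_ge0// ltW.
move=> h; have : (2 * eps)^-1 * nrm f ^+ 2 <= (2 * eps)^-1 * eps ^+ 2.
  by rewrite ler_wpM2l// invr_ge0 mulr_ge0// ltW.
have -> : (2 * eps)^-1 * eps ^+ 2 = eps / 2 by field; rewrite gt_eqF.
lra.
Qed.

(** By coordinates, since the limit theorems that are used concern real functions. *)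
Definition ae_cvg (u : nat -> L0 R) h := {ae m, forall x,
  (fun k => Re (u k x)) @ \oo --> Re (h x) /\ (fun k => Im (u k x)) @ \oo --> Im (h x)}.

(** Multiplication by the indicator of the complement of a null set makes the
    sequence converge everywhere, so that its pointwise limit is measurable. *)
Lemma ae_cvg_of_cvg (u : nat -> L0 R) :
  {ae m, forall x, cvgn (fun k => Re (u k x)) /\ cvgn (fun k => Im (u k x))} ->
  exists h, ae_cvg u h.
Proof.
move=> cu; have [N [mN N0 sN]] := cu.
have cN x : ~ N x -> cvgn (fun k => Re (u k x)) /\ cvgn (fun k => Im (u k x)).
  by apply: contra_notP; exact: sN.
have mI : measurable_fun setT (\1_(~` N) : circle R -> R).
  by apply: measurable_indic; exact: measurableC.
have key (F : C -> R) : (forall g, measurable_fun setT (fun x => F (g x))) ->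
    (forall x, ~ N x -> cvgn (fun k => F (u k x))) ->
    exists H : circle R -> R, measurable_fun setT H /\
      forall x, ~ N x -> (fun k => F (u k x)) @ \oo --> H x.
  move=> mF cF; exists (fun x => limn (fun k => F (u k x) * \1_(~` N) x)); split.
    apply: (@measurable_fun_cvg _ _ _ _ (fun k x => F (u k x) * \1_(~` N) x)).
      by move=> k; exact: measurable_funM.
    move=> x _; have [Nx|Nx] := pselect (N x).
      rewrite indicE memNset; last by move=> /= /(_ Nx).
      rewrite (_ : (fun k => F (u k x) * 0%:R) = cst 0); first exact: is_cvg_cst.
      by apply/funext => k; rewrite mulr0.
    rewrite indicE mem_set//.
    rewrite (_ : (fun k => F (u k x) * 1%:R) = (fun k => F (u k x))); first exact: cF.
    by apply/funext => k; rewrite mulr1.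
  move=> x Nx; rewrite indicE mem_set//.
  rewrite (_ : (fun k => F (u k x) * 1%:R) = (fun k => F (u k x))); first exact: cF.
  by apply/funext => k; rewrite mulr1.
have [HR [mR cR]] := key Re (@measurable_Re R) (fun x Nx => (cN x Nx).1).
have [HI [mI' cI]] := key Im (@measurable_Im R) (fun x Nx => (cN x Nx).2).
have mH : (fun x => HR x +i* HI x) \in @cmeasurable R by rewrite inE; split.
exists (\pi_(L0 R) (CMFun mH)).
have nN : {ae m, forall x, ~ N x}.
  by exists N; split => // x /= /contrapT.
by apply: filterS2 nN (pi_ae (CMFun mH)) => x Nx -> /=; split; [exact: cR|exact: cI].
Qed.

(** The integrals of the functions [|u (k + 1) - u k|] have a finite sum. So the
    sum of these functions is integrable, hence finite almost everywhere. *)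
Lemma fast_cauchy_ae_cvg (u : nat -> L0 R) : (forall k, L2 (u k)) ->
  (forall k, nrm (u k.+1 - u k) <= 1 / (2 ^ (k + 1))%:R) ->
  exists h, ae_cvg u h.
Proof.
move=> lu uc; apply: ae_cvg_of_cvg.
pose d k x : R := normc ((u k.+1 - u k : L0 R) x).
have md k : measurable_fun setT (EFin \o d k) by apply/measurable_EFinP; exact:
  measurable_normc.
have d0 k x : (0 <= (EFin \o d k) x)%E by rewrite lee_fin normc_ge0.
have Ile : (\int[m]_x (\sum_(k <oo) (EFin \o d k) x) < +oo)%E.
  rewrite integral_nneseries//.
  have h := @cvg_geometric_eseries_half R 1 0%N.
  apply: (@le_lt_trans _ _ (limn (eseries (fun k => (1 / (2 ^ (k + 1))%:R : R)%:E)))).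
    rewrite [leRHS](_ : _ = \sum_(k <oo) (1 / (2 ^ (k + 1))%:R : R)%:E)%E//.
    apply: lee_nneseries; first by move=> k _ _; exact: integral_ge0.
    by move=> k _; apply: integral_normc_le; rewrite ?divr_gt0 ?ltr0n ?expn_gt0//;
      exact: L2B.
  by rewrite (cvg_lim _ h)// expr0 divr1 ltry.
have ae1 : {ae m, forall x, (\sum_(k <oo) (EFin \o d k) x < +oo)%E}.
  have mS : measurable_fun setT (fun x => \sum_(k <oo) (EFin \o d k) x)%E.
    by apply: ge0_emeasurable_sum.
  have S0 x : (0 <= \sum_(k <oo) (EFin \o d k) x)%E by exact: nneseries_ge0.
  have iS : m.-integrable setT (fun x => \sum_(k <oo) (EFin \o d k) x)%E.
    apply/integrableP; split => //.
    by under eq_integral do rewrite gee0_abs//.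
  by apply: filterS (integrable_ae measurableT iS) => x /(_ I); rewrite ge0_fin_numE.
have aed : {ae m, forall x, forall k, d k x = normc (u k.+1 x - u k x)}.
  apply/ae_foralln => k; rewrite /d.
  apply: filterS2 (L0D_ae (u k.+1) (- u k)) (L0N_ae (u k)) => x -> ->//.
apply: filterS2 ae1 aed => x S dE; split.
- apply: (series_cvg (d := d^~ x)) => // k; rewrite dE.
  by apply: le_trans (Re_normc _); case: (u k.+1 x) (u k x) => [a b] [c e].
- apply: (series_cvg (d := d^~ x)) => // k; rewrite dE.
  by apply: le_trans (Im_normc _); case: (u k.+1 x) (u k x) => [a b] [c e].
Qed.

Lemma fatou_L2 (g : nat -> L0 R) h (c : R) : (forall j, L2 (g j)) ->
  (forall j, nsq (g j) <= c) -> ae_cvg g h -> L2 h /\ nsq h <= c.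
Proof.
move=> lg gc gh.
have c0 : 0 <= c by exact: le_trans (nsq_ge0 (g 0%N)) (gc 0%N).
pose F j x := (normc (g j x) ^+ 2)%:E.
have mF j : measurable_fun setT (F j) by apply/measurable_EFinP; exact:
  measurable_normc_sqr.
have F0 j x : (0 <= F j x)%E by rewrite lee_fin sqr_ge0.
have IF j : (\int[m]_x F j x <= c%:E)%E.
  have /L2_sqr l2 := lg j.
  by rewrite -(fineK (integrable_fin_num measurableT l2)) lee_fin; exact: gc.
have Ile : (\int[m]_x (normc (h x) ^+ 2)%:E <= c%:E)%E.
  apply: (@le_trans _ _ (\int[m]_x limn_einf (F ^~ x))%E).
    rewrite le_eqVlt; apply/orP; left; apply/eqP; apply: ae_eq_integral => //.
    - by apply/measurable_EFinP; exact: measurable_normc_sqr.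
    - rewrite (_ : (fun x => _) = (fun x => - limn_esup (fun j => - F j x))%E)//.
      apply: measurableT_comp => //; apply: measurable_fun_limn_esup => j.
      exact: measurableT_comp.
    - apply: filterS gh => x [cR cI] _.
      have /cvg_limn_einf_sup[-> _]// : F ^~ x @ \oo --> (normc (h x) ^+ 2)%:E.
      apply: cvg_EFin; first by near=> n.
      rewrite /comp /= normc_sqr.
      under eq_fun do rewrite normc_sqr.
      by apply: cvgD; rewrite expr2; under eq_fun do rewrite expr2; exact: cvgM.
  apply: le_trans (fatou m measurableT mF (fun n x _ => F0 n x)) _.
  rewrite limn_einf_lim; apply: lime_le; first exact: is_cvg_einfs.
  near=> n; apply: le_trans (IF n).
  by apply: ereal_inf_lbound; exists n => /=.
have lh : L2 h.
  apply/L2_sqr/integrableP; split; first by apply/measurable_EFinP; exact: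
    measurable_normc_sqr.
  under eq_integral do rewrite gee0_abs ?lee_fin ?sqr_ge0//.
  by apply: le_lt_trans Ile _; exact: ltry.
split => //; rewrite -lee_fin /nsq /Rintegral.
by have /L2_sqr l2 := lh; rewrite (fineK (integrable_fin_num measurableT l2)).
Unshelve. all: by end_near. Qed.

Definition L2_cvg (s : nat -> L0 R) h :=
  forall eps : R, 0 < eps -> exists N, forall n, (N <= n)%N -> nrm (s n - h) <= eps.

(** A subsequence with geometrically decreasing steps converges almost everywhere,
    and Fatou's lemma bounds the distance of its terms to the limit in norm. *)
Theorem L2_complete (s : nat -> L0 R) : (forall k, L2 (s k)) ->
  (forall eps : R, 0 < eps -> exists N, forall i j, (N <= i)%N -> (N <= j)%N ->
     nrm (s i - s j) <= eps) ->
  exists h, L2 h /\ L2_cvg s h.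
Proof.
move=> ls cs.
pose ep k : R := 1 / (2 ^ (k + 1))%:R.
have ep0 k : 0 < ep k by rewrite divr_gt0// ltr0n expn_gt0.
have /choice[N HN] : forall k, exists N, forall i j, (N <= i)%N -> (N <= j)%N ->
  nrm (s i - s j) <= ep k by move=> k; exact: cs.
(* Taking maxima makes the indices of the subsequence nondecreasing. *)
pose M k := (\max_(i < k.+1) N i)%N.
have NM k j : (k <= j)%N -> (N k <= M j)%N.
  move=> kj; have kj' : (k < j.+1)%N by [].
  exact: (@leq_bigmax _ (fun i : 'I_j.+1 => N i) (Ordinal kj')).
pose u k := s (M k).
have uc k j : (k <= j)%N -> nrm (u j - u k) <= ep k.
  by move=> kj; apply: HN; apply: NM.
have lu k : L2 (u k) by exact: ls.
have [h uh] : exists h, ae_cvg u h.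
  by apply: fast_cauchy_ae_cvg => // k; apply: uc.
have hu k : L2 (h - u k) /\ nsq (h - u k) <= ep k ^+ 2.
  apply: (@fatou_L2 (fun j => u (j + k)%N - u k)).
  - by move=> j; exact: L2B.
  - move=> j; rewrite -nrm_sqr; last exact: L2B.
    by rewrite ler_sqr ?nnegrE ?nrm_ge0 ?(ltW (ep0 k))//; apply: uc; rewrite leq_addl.
  - have a1 : {ae m, forall x, forall j, L0_fun (u (j + k)%N - u k) x = u (j + k)%N x -
    u k x}.
      apply/ae_foralln => j.
      by apply: filterS2 (L0D_ae (u (j + k)%N) (- u k)) (L0N_ae (u k)) => x -> ->.
    have a2 : {ae m, forall x, L0_fun (h - u k) x = h x - u k x}.
      by apply: filterS2 (L0D_ae h (- u k)) (L0N_ae (u k)) => x -> ->.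
    apply: filterS3 uh a1 a2 => x [cR cI] e1 e2; rewrite e2.
    have ReB (z w : C) : Re (z - w) = Re z - Re w by case: z w => [? ?] [].
    have ImB (z w : C) : Im (z - w) = Im z - Im w by case: z w => [? ?] [].
    split.
    + under eq_fun do rewrite e1 ReB.
      rewrite ReB; apply: cvgB; last exact: cvg_cst.
      by rewrite (cvg_shiftn k (fun j => Re (u j x))).
    + under eq_fun do rewrite e1 ImB.
      rewrite ImB; apply: cvgB; last exact: cvg_cst.
      by rewrite (cvg_shiftn k (fun j => Im (u j x))).
have lh : L2 h by rewrite -(subrK (u 0%N) h); apply: L2D => //; have [] := hu 0%N.
have nhu k : nrm (h - u k) <= ep k.
  rewrite -ler_sqr ?nnegrE ?nrm_ge0 ?(ltW (ep0 k))// nrm_sqr; last exact: L2B.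
  by have [] := hu k.
exists h; split => // eps eps0.
have [k ek] : exists k, ep k <= eps / 2.
  have : (fun k => 2^-1 ^+ k : R) @ \oo --> (0 : R).
    by apply: cvg_expr; rewrite ger0_norm//; lra.
  move=> /cvgrPdist_le /(_ (eps / 2)); rewrite divr_gt0// => /(_ isT)[k _ /(_ k)] /=.
  rewrite leqnn => /(_ isT); rewrite sub0r normrN ger0_norm ?exprn_ge0 ?invr_ge0// => h1.
  exists k; apply: le_trans h1; rewrite /ep mul1r natrX -exprVn.
  by rewrite addn1 exprS ler_piMl ?exprn_ge0 ?invr_ge0//; lra.
exists (maxn (N k) (M k)) => n; rewrite geq_max => /andP[Nn Mn].
have -> : s n - h = (s n - u k) + (u k - h) by rewrite addrA subrK.
apply: le_trans (nrmD _ _) _; [exact: L2B|exact: L2B|].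
rewrite (nrmB (lu k) lh); have : nrm (s n - u k) <= ep k.
  by apply: HN => //; exact: NM.
by have := nhu k; lra.
Qed.

End Completeness.

(** * The Hardy space and the backward shift *)

(* Simplification would turn an inner product into a pair of real integrals. *)
#[local] Arguments L0_zpow : simpl never.
#[local] Arguments fourier : simpl never.
#[local] Arguments L2_dot : simpl never.
#[local] Arguments cintegral : simpl never.
#[local] Arguments conjc : simpl never.

Section Hardy.
Variable R : realType.
Local Notation C := R[i].
Implicit Types (f g h u q : L0 R) (c : C) (s : nat -> L0 R).
Local Notation "<| f , g |>" := (L2_dot f g) (at level 0, f, g at level 99).
Local Notation nrm := (@L2_norm R).
Local Notation e := (@L0_zpow R).
Local Notation z := (@L0_z R).

(** Stated with the real modulus [normc], which is what the Cauchy-Schwarz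
    inequality bounds. *)
Definition C_cvg (a : nat -> C) (l : C) :=
  forall eps : R, 0 < eps -> exists N, forall n, (N <= n)%N -> normc (a n - l) <= eps.

Lemma C_cvg_unique a l k : C_cvg a l -> C_cvg a k -> l = k.
Proof.
move=> cl ck; apply/eqP; rewrite -subr_eq0; apply/eqP; apply: eq0_normc; apply/eqP.
rewrite eq_le normc_ge0 andbT; apply/ler_addgt0Pr => eps eps0; rewrite add0r.
have e2 : 0 < eps / 2 by rewrite divr_gt0.
have [N HN] := cl _ e2; have [M HM] := ck _ e2.
have := HN (maxn N M) (leq_maxl _ _); have := HM (maxn N M) (leq_maxr _ _).
set x := a _; rewrite -[normc (x - l)]normcN opprB => h1 h2.
have -> : l - k = (l - x) + (x - k) by rewrite addrA subrK.
apply: le_trans (le_normcD _ _) _; lra.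
Qed.

Lemma C_cvg_cst c : C_cvg (fun=> c) c.
Proof. by move=> eps e0; exists 0%N => n _; rewrite subrr normc0 ltW. Qed.

Lemma C_cvgD a b l k : C_cvg a l -> C_cvg b k -> C_cvg (fun n => a n + b n) (l + k).
Proof.
move=> al bk eps eps0; have e2 : 0 < eps / 2 by rewrite divr_gt0.
have [N HN] := al _ e2; have [M HM] := bk _ e2.
exists (maxn N M) => n; rewrite geq_max => /andP[/HN h1 /HM h2].
rewrite opprD addrACA; apply: le_trans (le_normcD _ _) _; lra.
Qed.

Lemma C_cvgM a l k : C_cvg a l -> C_cvg (fun n => k * a n) (k * l).
Proof.
move=> al eps eps0.
have k0 : 0 < normc k + 1 by rewrite ltr_wpDl ?normc_ge0.
have [N HN] := al _ (divr_gt0 eps0 k0).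
exists N => n /HN h; rewrite -mulrBr normcM.
have := normc_ge0 (a n - l); move: (normc (a n - l)) h => x.
rewrite ler_pdivlMr// => h x0; move: h; rewrite mulrDr mulr1 mulrC; lra.
Qed.

Lemma C_cvgN a l : C_cvg a l -> C_cvg (fun n => - a n) (- l).
Proof.
move=> al; have := C_cvgM (-1) al; rewrite mulN1r.
by rewrite (_ : (fun n => _) = (fun n => - a n))//; apply/funext => n; rewrite mulN1r.
Qed.

Lemma C_cvgB a b l k : C_cvg a l -> C_cvg b k -> C_cvg (fun n => a n - b n) (l - k).
Proof. by move=> al bk; apply: C_cvgD => //; exact: C_cvgN. Qed.

Lemma C_cvg_conj a l : C_cvg a l -> C_cvg (fun n => conjc (a n)) (conjc l).
Proof.
move=> al eps /al[N HN]; exists N => n /HN.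
by rewrite -rmorphB normc_conj.
Qed.

Lemma C_cvg_eq a b l : C_cvg a l -> a =1 b -> C_cvg b l.
Proof. by move=> al /funext <-. Qed.

Lemma C_cvg_eventually a c l N : C_cvg a l -> (forall n, (N <= n)%N -> a n = c) -> l = c.
Proof.
move=> al an; apply: (C_cvg_unique al) => eps e0; exists N => n /an ->.
by rewrite subrr normc0 ltW.
Qed.

Lemma dot_cvgl s h g : (forall n, L2 (s n)) -> L2 h -> L2 g -> L2_cvg s h ->
  C_cvg (fun n => <|s n, g|>) <|h, g|>.
Proof.
move=> ls lh lg sh eps eps0.
have g0 : 0 < nrm g + 1 by rewrite ltr_wpDl ?nrm_ge0.
have [N HN] := sh _ (divr_gt0 eps0 g0).
exists N => n /HN hn; rewrite -dotBl//.
apply: le_trans (cauchy_schwarz _ lg) _; first exact: L2B.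
have := nrm_ge0 (s n - h); move: (nrm (s n - h)) hn => x.
rewrite ler_pdivlMr// => hn x0; move: hn; rewrite mulrDr mulr1; lra.
Qed.

Lemma dot_cvgr s h g : (forall n, L2 (s n)) -> L2 h -> L2 g -> L2_cvg s h ->
  C_cvg (fun n => <|g, s n|>) <|g, h|>.
Proof.
move=> ls lh lg sh; rewrite (dotC lg lh).
apply: (C_cvg_eq (C_cvg_conj (dot_cvgl ls lh lg sh))) => n.
by rewrite -dotC.
Qed.

(** Only the frequencies in [[0, n[] are kept, so that for [f] in [L2] the limit is
    the Riesz projection of [f]. *)
Definition psum f n : L0 R := \sum_(k < n) fourier f k%:Z *: e k%:Z.

Lemma L2_psum f n : L2 (psum f n).
Proof. by apply: (L2_sum (F := fun k : nat => fourier f k%:Z *: e k%:Z)) => k _; apply: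
  L2Z; exact: L2_zpow. Qed.

Lemma psumS f n : psum f n.+1 = psum f n + fourier f n%:Z *: e n%:Z.
Proof. by rewrite /psum big_ord_recr. Qed.

Lemma psum_dot f n h : L2 h -> <|psum f n, h|> = \sum_(k < n) fourier f k%:Z * conjc
  (fourier h k%:Z).
Proof.
move=> lh; rewrite (dot_suml (F := fun k : nat => fourier f k%:Z *: e k%:Z))//; last
  first.
  by move=> k _; apply: L2Z; exact: L2_zpow.
apply: eq_bigr => k _; rewrite dotZl//; last exact: L2_zpow.
by congr (_ * _); rewrite /fourier dotC//; exact: L2_zpow.
Qed.

Lemma fourier_psum_lt f n (k : nat) : (k < n)%N -> fourier (psum f n) k = fourier f k.
Proof.
move=> kn; rewrite /fourier psum_dot; last exact: L2_zpow.
rewrite (bigD1 (Ordinal kn))//= fourier_zpow eqxx conjc1 mulr1 big1 ?addr0// => j jk.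
rewrite fourier_zpow; case: eqP => [[]kj|_]; last by rewrite conjc0 mulr0.
by move: jk; rewrite -val_eqE /= kj eqxx.
Qed.

Lemma fourier_psum_out f n (j : int) : (j < 0) || (n%:Z <= j) -> fourier (psum f n) j = 0.
Proof.
move=> jn; rewrite /fourier psum_dot; last exact: L2_zpow.
apply: big1 => k _; rewrite fourier_zpow.
case: eqP => [kj|_]; last by rewrite conjc0 mulr0.
by move: jn; rewrite kj; have := ltn_ord k; lia.
Qed.

Lemma dot_psum f n j : L2 f -> (j <= n)%N -> <|f - psum f n, psum f j|> = 0.
Proof.
move=> lf jn; rewrite dotC; [|exact: L2B lf (L2_psum _ _)|exact: L2_psum].
rewrite psum_dot; last exact: L2B lf (L2_psum _ _).
rewrite big1 ?conjc0// => k _.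
rewrite fourierB//; last exact: L2_psum.
rewrite (fourier_psum_lt f (n := n)) ?subrr ?conjc0 ?mulr0//.
exact: leq_trans (ltn_ord k) jn.
Qed.

Lemma psum_pythagoras f i j : L2 f -> (i <= j)%N ->
  nsq (f - psum f i) = nsq (f - psum f j) + nsq (psum f j - psum f i).
Proof.
move=> lf ij.
have l1 n : L2 (f - psum f n) by apply: L2B => //; exact: L2_psum.
have l2 : L2 (psum f j - psum f i) by apply: L2B; exact: L2_psum.
have -> : f - psum f i = (f - psum f j) + (psum f j - psum f i) by rewrite addrA subrK.
rewrite nsqD// dotBr//; [|exact: L2_psum|exact: L2_psum].
by rewrite !dot_psum// subrr /= mulr0 addr0.
Qed.

(** By Pythagoras the squared distance from [f] to [psum f n] decreases with [n],
    and its decrements are the squared distances between partial sums. *)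
Lemma psum_cauchy f : L2 f -> forall eps : R, 0 < eps ->
  exists N, forall i j, (N <= i)%N -> (N <= j)%N -> nrm (psum f i - psum f j) <= eps.
Proof.
move=> lf eps eps0; pose a n := nsq (f - psum f n).
have na : nonincreasing_seq a.
  by move=> i j ij; rewrite /a (psum_pythagoras lf ij) lerDl nsq_ge0.
have ca : cvgn a.
  by apply: nonincreasing_is_cvgn => //; exists 0 => _ [n _ <-]; exact: nsq_ge0.
have e2 : 0 < eps ^+ 2 / 2 by rewrite divr_gt0// exprn_gt0.
(* Two values of [a] at distance [eps^2 / 2] from the limit differ by at most [eps^2]. *)
have := ca => /cvgrPdist_le /(_ _ e2)[N _ HN].
exists N.
have key i j : (N <= i)%N -> (i <= j)%N -> nrm (psum f j - psum f i) <= eps.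
  move=> Ni ij; rewrite -ler_sqr ?nnegrE ?nrm_ge0 ?(ltW eps0)//.
  rewrite nrm_sqr; last by apply: L2B; exact: L2_psum.
  have h1 := HN i Ni; have h2 := HN j (leq_trans Ni ij).
  have := psum_pythagoras lf ij; rewrite -/(a i) -/(a j).
  move: h1 h2; rewrite /= !ler_norml => /andP[h1 h1'] /andP[h2 h2'].
  by move: (nsq _) (limn a) h1 h1' h2 h2' => x l *; lra.
move=> i j Ni Nj; case: (leqP j i) => [ji|/ltnW ij]; first exact: key.
by rewrite nrmB; [exact: key|exact: L2_psum|exact: L2_psum].
Qed.

Lemma H2_L2 f : H2 f -> L2 f. Proof. by case. Qed.

(** Completeness gives the limit of the partial sums, and Fourier coefficients
    are continuous. *)
Theorem riesz_proj f : L2 f -> exists h,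
  [/\ H2 h, L2_cvg (psum f) h & forall n : nat, fourier h n%:Z = fourier f n%:Z].
Proof.
move=> lf.
have [h [lh ch]] := L2_complete (L2_psum f) (psum_cauchy lf).
exists h.
have cf n := dot_cvgl (L2_psum f) lh (L2_zpow R n) ch.
split => //.
  split=> // n n0; apply: (C_cvg_eventually (N := 0) (cf n)) => k _.
  by apply: fourier_psum_out; rewrite n0.
move=> n; apply: (C_cvg_eventually (N := n.+1) (cf n%:Z)) => k nk.
exact: fourier_psum_lt.
Qed.

(** [f] and the limit of its partial sums have the same Fourier coefficients. *)
Lemma psum_cvg f : H2 f -> L2_cvg (psum f) f.
Proof.
move=> [lf f0]; have [h [[lh h0] ch hf]] := riesz_proj lf.
suff fh : f = h by rewrite {2}fh.
apply/eqP; rewrite -subr_eq0; apply/eqP; apply: fourier_unique; first exact: L2B.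
move=> n; rewrite fourierB//; case: n => n; first by rewrite hf subrr.
by rewrite f0 ?h0 ?subrr.
Qed.

Lemma dot_antianalytic q g : L2 q -> (forall n : nat, fourier q n%:Z = 0) -> H2 g ->
  <|q, g|> = 0.
Proof.
move=> lq q0 Hg; have lg := H2_L2 Hg.
apply: (C_cvg_eventually (N := 0) (dot_cvgr (L2_psum g) lg lq (psum_cvg Hg))) => n _.
rewrite dotC//; last exact: L2_psum.
by rewrite psum_dot// big1 ?conjc0// => k _; rewrite q0 conjc0 mulr0.
Qed.

Lemma hardy_proj f : L2 f -> exists h, H2 h /\ forall g, H2 g -> <|f - h, g|> = 0.
Proof.
move=> lf; have [h [Hh _ hf]] := riesz_proj lf; exists h; split => // g Hg.
apply: dot_antianalytic => //; first by apply: L2B => //; exact: H2_L2.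
by move=> n; rewrite fourierB ?hf ?subrr//; exact: H2_L2.
Qed.

Lemma H2D f g : H2 f -> H2 g -> H2 (f + g).
Proof.
move=> [lf f0] [lg g0]; split; first exact: L2D.
by move=> n n0; rewrite fourierD// f0// g0// addr0.
Qed.

Lemma H2Z c f : H2 f -> H2 (c *: f).
Proof. by move=> [lf f0]; split=> [|n n0]; rewrite ?fourierZ ?f0 ?mulr0//; exact: L2Z.
  Qed.

Lemma H2B f g : H2 f -> H2 g -> H2 (f - g).
Proof. by move=> Hf Hg; apply: H2D => //; rewrite -scaleN1r; exact: H2Z. Qed.

Lemma H2_zpow (n : nat) : H2 (e n%:Z).
Proof.
split=> [|k k0]; first exact: L2_zpow.
by rewrite fourier_zpow; case: eqP => // nk; move: k0; rewrite -nk.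
Qed.

Lemma H2_1 : H2 (1 : L0 R).
Proof. by rewrite -(zpow0 R); exact: (H2_zpow 0). Qed.

Lemma H2_zM f : H2 f -> H2 (z * f).
Proof.
move=> [lf f0]; rewrite -(zpow1 R); split; first exact: L2_zpowM.
by move=> n n0; rewrite fourierM f0//; lia.
Qed.

(** The coefficient of [u g] is the inner product of [g] with [conj u z^n], so
    the partial sums of [g] may be substituted for [g]. *)
Lemma fourierM_cvg u g n : Linf u -> L2 u -> H2 g ->
  C_cvg (fun N => \sum_(k < N) fourier g k%:Z * fourier u (n - k%:Z)) (fourier (u * g) n).
Proof.
move=> bu lu Hg; have lg := H2_L2 Hg.
have lue : L2 (L0_conj u * e n) by apply: LinfM_L2; [exact: Linf_conj|exact: L2_zpow].
have := dot_cvgl (L2_psum g) lg lue (psum_cvg Hg).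
rewrite -dotMl => h; apply: (C_cvg_eq h) => N.
rewrite psum_dot//; apply: eq_bigr => k _; congr (_ * _).
rewrite mulrC fourierM fourier_conj// conjcK; congr (fourier _ _); lia.
Qed.

Lemma H2M u g : Linf u -> H2 u -> H2 g -> H2 (u * g).
Proof.
move=> bu [lu u0] Hg; split; first by apply: LinfM_L2 => //; exact: H2_L2.
move=> n n0; apply: (C_cvg_eventually (N := 0) (@fourierM_cvg u g n bu lu Hg)) => N _.
by apply: big1 => k _; rewrite u0 ?mulr0//; lia.
Qed.

Lemma fourierM0 u g : Linf u -> H2 u -> H2 g -> fourier (u * g) 0 = fourier u 0 *
  fourier g 0.
Proof.
move=> bu [lu u0] Hg; apply: (C_cvg_eventually (N := 1) (@fourierM_cvg u g 0 bu lu Hg))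
  => -[//|N] _.
rewrite big_ord_recl /= subr0 big1 ?addr0; first by rewrite mulrC.
by move=> k _; rewrite u0 ?mulr0// /bump; lia.
Qed.

(** The backward shift: on [H2] it is the adjoint of multiplication by the
    coordinate, and on a model space the adjoint of the compressed shift. *)
Definition bshift f : L0 R := L0_conj z * (f - L0_cst (fourier f 0)).

Lemma L2_cst c : L2 (L0_cst c).
Proof. by apply: Linf_sub_L2; exact: Linf_cst. Qed.

Lemma cstE c : L0_cst c = c *: (1 : L0 R).
Proof. by rewrite L0_scaleE mulr1. Qed.

Lemma L2_bshift f : L2 f -> L2 (bshift f).
Proof.
move=> lf; rewrite /bshift -(zpowN1 R); apply: L2_zpowM; apply: L2B => //.
exact: L2_cst.
Qed.

Lemma Linf_bshift f : Linf f -> Linf (bshift f).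
Proof.
move=> lf; rewrite /bshift -(zpowN1 R); apply: LinfM; first exact: Linf_zpow.
apply: LinfD => //; apply: LinfN; exact: Linf_cst.
Qed.

(** This shows that the iterates of the backward shift tend to 0 in norm on [H2]. *)
Lemma iter_bshift n f : L2 f -> iter n bshift f = e (- n%:Z) * (f - psum f n).
Proof.
move=> lf; elim: n => [|n IH].
  by rewrite /= oppr0 zpow0 mul1r /psum big_ord0 subr0.
rewrite iterS IH {IH} /bshift fourierM sub0r opprK.
rewrite fourierB//; last exact: L2_psum.
rewrite fourier_psum_out ?lexx ?orbT// subr0 psumS.
have -> : - n.+1%:Z = - 1 + - n%:Z by lia.
rewrite zpowD zpowN1 -mulrA; congr (_ * _).
rewrite opprD addrA [in RHS]mulrBr; congr (_ - _).
by rewrite !L0_scaleE mulrCA -zpowD addNr zpow0 mulr1.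
Qed.

Lemma H2_bshift f : H2 f -> H2 (bshift f).
Proof.
move=> [lf f0]; split; first exact: L2_bshift.
move=> n n0; rewrite /bshift -(zpowN1 R) fourierM fourierB//; last exact: L2_cst.
rewrite cstE fourierZ; last exact: L2_1.
rewrite -(zpow0 R) fourier_zpow.
have [->|nN1] := eqVneq n (-1); first by rewrite opprK addNr eqxx mulr1 subrr.
rewrite f0; last by lia.
by rewrite (_ : (0 == n - -1) = false) ?mulr0 ?subr0//; apply/negbTE/eqP; lia.
Qed.

(** The part of [conj z h] that [bshift h] omits is a multiple of [conj z], which is
    orthogonal to [H2]. *)
Lemma dot_zM g h : H2 g -> L2 h -> <|z * g, h|> = <|g, bshift h|>.
Proof.
move=> [lg g0] lh; rewrite dotMl /bshift mulrBr.
have l1 : L2 (L0_conj z * h) by rewrite -(zpowN1 R); exact: L2_zpowM.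
have l2 : L2 (L0_conj z * L0_cst (fourier h 0)).
  by rewrite -(zpowN1 R); apply: L2_zpowM; exact: L2_cst.
rewrite dotBr// [X in _ - X](_ : _ = 0) ?subr0//.
rewrite mulrC -L0_scaleE -(zpowN1 R) dotZr//; last exact: L2_zpow.
by rewrite -/(fourier g (-1)) g0 ?mulr0.
Qed.

Lemma nrm_iter_bshift n f : L2 f -> nrm (iter n bshift f) = nrm (f - psum f n).
Proof.
move=> lf; rewrite iter_bshift//; apply: nrm_zpowM.
by apply: L2B => //; exact: L2_psum.
Qed.

Lemma nrm_psum_le n f : L2 f -> nrm (f - psum f n) <= nrm f.
Proof.
move=> lf; rewrite -ler_sqr ?nnegrE ?nrm_ge0// !nrm_sqr//; last first.
  by apply: L2B => //; exact: L2_psum.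
have := psum_pythagoras lf (leq0n n); rewrite {1}/psum big_ord0 subr0 => ->.
by rewrite lerDl nsq_ge0.
Qed.

End Hardy.

(** * Model spaces *)

Section ModelSpace.
Variable R : realType.
Local Notation C := R[i].
Implicit Types (f g h u q : L0 R) (c : C) (s : nat -> L0 R).
Local Notation "<| f , g |>" := (L2_dot f g) (at level 0, f, g at level 99).
Local Notation nrm := (@L2_norm R).
Local Notation e := (@L0_zpow R).
Local Notation z := (@L0_z R).
Local Notation K := (@model_space R).

Lemma inner_H2 u : inner_function u -> H2 u. Proof. by case. Qed.
Lemma inner_unimod u : inner_function u -> u * L0_conj u = 1.
Proof. by case=> _; exact: unimod_conj. Qed.
Lemma inner_Linf u : inner_function u -> Linf u.
Proof. by case=> _; exact: unimod_Linf. Qed.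

Lemma model_H2 u f : K u f -> H2 f. Proof. by case. Qed.
Lemma model_L2 u f : K u f -> L2 f. Proof. by case=> /H2_L2. Qed.

Lemma L2_inner u f : inner_function u -> L2 f -> L2 (u * f).
Proof. by move=> /inner_Linf; exact: LinfM_L2. Qed.

Lemma modelD u f g : inner_function u -> K u f -> K u g -> K u (f + g).
Proof.
move=> iu [Hf f0] [Hg g0]; split; first exact: H2D.
move=> h Hh; rewrite dotDl ?f0 ?g0 ?addr0//; [exact: H2_L2|exact: H2_L2|].
by apply: L2_inner => //; exact: H2_L2.
Qed.

Lemma modelZ u c f : inner_function u -> K u f -> K u (c *: f).
Proof.
move=> iu [Hf f0]; split; first exact: H2Z.
move=> h Hh; rewrite dotZl ?f0 ?mulr0//; first exact: H2_L2.
by apply: L2_inner => //; exact: H2_L2.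
Qed.

Lemma modelB u f g : inner_function u -> K u f -> K u g -> K u (f - g).
Proof. by move=> iu kf kg; apply: modelD => //; rewrite -scaleN1r; exact: modelZ. Qed.

Lemma model0 u : inner_function u -> K u 0.
Proof.
move=> iu; split; first by rewrite -(scale0r (1 : L0 R)); apply: H2Z; exact: H2_1.
by move=> h Hh; rewrite dot0l.
Qed.

(** With [P] the Riesz projection, the projection of [f] onto the model space is
    [P f - u P (conj u P f)]: what is subtracted is the projection of [P f] onto
    [u H2], because multiplication by [u] is isometric. *)
Lemma model_proj_ex u f : inner_function u -> L2 f ->
  exists g, K u g /\ forall h, K u h -> <|f - g, h|> = 0.
Proof.
move=> iu lf; have Hu := inner_H2 iu; have bu := inner_Linf iu.
have [p [Hp p0]] := hardy_proj lf.
have lp := H2_L2 Hp.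
have lup : L2 (L0_conj u * p) by apply: LinfM_L2 => //; exact: Linf_conj.
have [q [Hq q0]] := hardy_proj lup.
have lq := H2_L2 Hq.
have Huq : H2 (u * q) by exact: H2M.
exists (p - u * q); split.
  split; first exact: H2B.
  move=> g Hg; have -> : p - u * q = u * (L0_conj u * p - q).
    by rewrite mulrBr mulrA inner_unimod// mul1r.
  rewrite dotMl mulrA (mulrC _ u) inner_unimod// mul1r; exact: q0.
move=> h [Hh h0].
have -> : f - (p - u * q) = (f - p) + u * q by rewrite opprB addrCA addrC.
rewrite dotDl ?p0 ?add0r//; [|exact: L2B|exact: H2_L2|exact: H2_L2].
by rewrite dotC ?h0 ?conjc0//; exact: H2_L2.
Qed.

Lemma model_projP u f : inner_function u -> L2 f ->
  K u (model_proj u f) /\ forall h, K u h -> <|f - model_proj u f, h|> = 0.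
Proof.
move=> iu lf; rewrite /model_proj /orthoproj.
by case: xgetP => [g _ //|/(_ _)]; have [g gP] := model_proj_ex iu lf; move=> /(_ g).
Qed.

Lemma model_proj_in u f : inner_function u -> L2 f -> K u (model_proj u f).
Proof. by move=> iu lf; case: (model_projP iu lf). Qed.

Lemma model_proj_dot u f h : inner_function u -> L2 f -> K u h ->
  <|model_proj u f, h|> = <|f, h|>.
Proof.
move=> iu lf kh; have [kp p0] := model_projP iu lf.
apply/esym/eqP; rewrite -subr_eq0 -dotBl//; [|exact: model_L2 kp|exact: model_L2 kh].
by rewrite p0.
Qed.

Lemma dot_model_proj u f h : inner_function u -> L2 f -> K u h ->
  <|h, model_proj u f|> = <|h, f|>.
Proof.
move=> iu lf kh; have kp := model_proj_in iu lf.
rewrite dotC ?model_proj_dot//; [|exact: model_L2 kh|exact: model_L2 kp].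
by rewrite -dotC//; exact: model_L2 kh.
Qed.

Lemma model_eq0 u f : K u f -> (forall h, K u h -> <|f, h|> = 0) -> f = 0.
Proof. by move=> kf f0; apply: dot_eq0; [exact: model_L2 kf|exact: f0]. Qed.

Lemma model_bshift u f : inner_function u -> K u f -> K u (bshift f).
Proof.
move=> iu [Hf f0]; have lf := H2_L2 Hf; split; first exact: H2_bshift.
move=> g Hg; have Hug := H2M (inner_Linf iu) (inner_H2 iu) Hg.
rewrite dotC; [|exact: L2_bshift|exact: H2_L2].
rewrite -dot_zM// mulrCA dotC; [|exact: H2_L2 (H2M (inner_Linf iu) (inner_H2 iu) (H2_zM
  Hg))|by []].
by rewrite f0 ?conjc0//; exact: H2_zM.
Qed.

(** By [dot_zM], [bshift f] satisfies the defining property of the adjoint; the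
    difference of two solutions in the model space is orthogonal to that space. *)
Lemma adjoint_shift u f : inner_function u -> K u f ->
  adjoint (K u) (compressed_shift u) f = bshift f.
Proof.
move=> iu kf; have kb := model_bshift iu kf.
have bP g : K u g -> <|compressed_shift u g, f|> = <|g, bshift f|>.
  move=> kg; rewrite /compressed_shift model_proj_dot//.
    by apply: dot_zM; [exact: model_H2 kg|exact: model_L2 kf].
  by apply: H2_L2; apply: H2_zM; exact: model_H2 kg.
rewrite /adjoint; case: xgetP => [h _ [kh hP]|/(_ (bshift f))]; last by case; split.
apply/eqP; rewrite -subr_eq0; apply/eqP.
have kd : K u (h - bshift f) by exact: modelB.
apply: (dot_eq0 (model_L2 kd)).
rewrite [LHS]dotBr; [|exact: model_L2 kh|exact: model_L2 kb|exact: model_L2 kd].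
by rewrite -hP// -bP// subrr.
Qed.

Lemma disc_value0 f : disc_value f 0 = fourier f 0.
Proof.
rewrite /disc_value.
have h : (fun n => \sum_(k < n) fourier f k%:Z * 0 ^+ k : C^o) @ \oo --> (fourier f 0 :
  C^o).
  apply: cvg_near_cst; exists 1%N => // n /= n0.
  case: n n0 => // n _; rewrite big_ord_recl expr0 mulr1 big1 ?addr0// => k _.
  by rewrite expr0n mulr0.
exact: (cvg_lim _ h).
Qed.

Lemma k0E u : k0 u = 1 - conjc (fourier u 0) *: u.
Proof. by rewrite /k0 disc_value0. Qed.

Lemma dot1l h : L2 h -> <|1, h|> = conjc (fourier h 0).
Proof.
by move=> lh; rewrite dotC//; exact: L2_1.
Qed.

Lemma dot1r h : <|h, 1|> = fourier h 0. Proof. by rewrite /fourier zpow0. Qed.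

(** [k0 u] is the projection of 1: it differs from 1 by a multiple of [u]. *)
Lemma k0_model u : inner_function u -> K u (k0 u).
Proof.
move=> iu; have Hu := inner_H2 iu; have lu := H2_L2 Hu.
rewrite k0E; split; first by apply: H2B; [exact: H2_1|exact: H2Z].
move=> g Hg; have lug := L2_inner iu (H2_L2 Hg).
rewrite dotBl//; [|exact: L2_1|exact: L2Z].
rewrite dot1l// dotZl// fourierM0//; last exact: inner_Linf.
have -> : <|u, u * g|> = conjc (fourier g 0).
  rewrite -{1}[u]mulr1 dotMl mulrA (mulrC _ u) inner_unimod// mul1r.
  by apply: dot1l; exact: H2_L2.
by rewrite rmorphM subrr.
Qed.

Lemma dot_k0 u f : inner_function u -> K u f -> <|f, k0 u|> = fourier f 0.
Proof.
move=> iu [Hf f0]; have Hu := inner_H2 iu; have lu := H2_L2 Hu; have lf := H2_L2 Hf.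
rewrite k0E dotBr//; [|exact: L2_1|exact: L2Z].
rewrite dotZr// dot1r -[X in <|f, X|>](mulr1 u) f0 ?mulr0 ?subr0//.
exact: H2_1.
Qed.

Lemma dot_inner_cancel u f g : inner_function u -> <|u * f, u * g|> = <|f, g|>.
Proof. by move=> iu; rewrite dotMl mulrA (mulrC _ u) inner_unimod// mul1r. Qed.

(** This is not an instance of [model_bshift], as [u] itself is orthogonal to its
    model space. *)
Lemma bshift_inner_model u : inner_function u -> K u (bshift u).
Proof.
move=> iu; have Hu := inner_H2 iu; have lu := H2_L2 Hu.
split; first exact: H2_bshift.
move=> g Hg; have Hug := H2M (inner_Linf iu) Hu Hg.
rewrite dotC; [|exact: L2_bshift|exact: H2_L2].
rewrite -dot_zM// mulrCA -{2}[u]mulr1 dot_inner_cancel// dot1r -(zpow1 R) fourierM.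
by case: Hg => _ ->//; rewrite conjc0.
Qed.

Lemma iter_bshift_model u f n : inner_function u -> K u f -> K u (iter n (@bshift R) f).
Proof. by move=> iu kf; elim: n => // n IH; exact: model_bshift. Qed.

Lemma iter_bshift_Linf f n : Linf f -> Linf (iter n (@bshift R) f).
Proof. by move=> kf; elim: n => // n IH; exact: Linf_bshift. Qed.

Lemma L0_conj_sum n (F : nat -> L0 R) :
  L0_conj (\sum_(k < n) F k) = \sum_(k < n) L0_conj (F k).
Proof. by elim: n => [|n IH]; rewrite ?big_ord0 ?L0_conj0// !big_ord_recr /= L0_conjD
  IH. Qed.

Lemma model_sum u n (F : nat -> L0 R) : inner_function u ->
  (forall k, (k < n)%N -> K u (F k)) -> K u (\sum_(k < n) F k).
Proof.
move=> iu; elim: n => [|n IH] FK; first by rewrite big_ord0; exact: model0.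
rewrite big_ord_recr /=; apply: modelD => //; last exact: FK.
by apply: IH => k kn; apply: FK; rewrite ltnS ltnW.
Qed.

Lemma Linf_sum n (F : nat -> L0 R) :
  (forall k, (k < n)%N -> Linf (F k)) -> Linf (\sum_(k < n) F k).
Proof.
elim: n => [|n IH] FK; first by rewrite big_ord0 -cst0; exact: Linf_cst.
rewrite big_ord_recr /=; apply: LinfD => //; last exact: FK.
by apply: IH => k kn; apply: FK; rewrite ltnS ltnW.
Qed.

(** The canonical conjugation of the model space, an antilinear isometric
    involution. *)
Definition model_conj u f : L0 R := u * (L0_conj z * L0_conj f).

(** The coefficient of index [- (k + 1)] of [model_conj u f] is the conjugate of
    [<f, u z^k>]. *)
Lemma model_conj_H2 u f : inner_function u -> K u f -> H2 (model_conj u f).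
Proof.
move=> iu [Hf f0]; have lf := H2_L2 Hf; split.
  apply: L2_inner => //; rewrite -(zpowN1 R); apply: L2_zpowM; exact: L2conj.
case=> // n _.
rewrite /fourier /model_conj mulrA mulrC -[e _]L0_conjK -[u * _]L0_conjK -L0_conjM.
have -> : <|L0_conj (f * L0_conj (u * L0_conj z)), L0_conj (L0_conj (e (Negz n)))|> =
  <|L0_conj (e (Negz n)), f * L0_conj (u * L0_conj z)|> by rewrite dot_conj.
rewrite dotC; [|by rewrite zpow_conj; exact: L2_zpow|]; last first.
  rewrite mulrC; apply: LinfM_L2 => //; apply: Linf_conj; apply: LinfM; first exact:
    inner_Linf.
  by rewrite -(zpowN1 R); exact: Linf_zpow.
rewrite mulrC dotMl L0_conjK zpow_conj -mulrA -(zpowN1 R) -zpowD f0 ?conjc0//.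
have -> : -1 + - Negz n = n%:Z by rewrite NegzE; lia.
exact: H2_zpow.
Qed.

Lemma model_conjK u f : inner_function u -> model_conj u (model_conj u f) = f.
Proof.
move=> iu; rewrite /model_conj !L0_conjM !L0_conjK.
have -> : u * (L0_conj z * (L0_conj u * (z * f))) =
  (u * L0_conj u) * ((z * L0_conj z) * f).
  by rewrite (mulrCA (L0_conj z)) -[RHS]mulrA -[z * L0_conj z * f]mulrA (mulrCA z).
by rewrite inner_unimod// mul_z_conj !mul1r.
Qed.

Lemma model_conj_psum u f n :
  model_conj u (psum f n) =
  \sum_(k < n) conjc (fourier f k%:Z) *: (e (- k.+1%:Z) * u).
Proof.
rewrite /model_conj (L0_conj_sum _ (fun k => fourier f k%:Z *: e k%:Z)) mulrA mulr_sumr.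
apply: eq_bigr => k _; rewrite L0_conjZ zpow_conj !L0_scaleE.
have -> : - k.+1%:Z = -1 + - k%:Z by lia.
by rewrite zpowD zpowN1 mulrCA -!mulrA; congr (_ * _); rewrite mulrC -mulrA.
Qed.

(** Applying [model_conj] to a Taylor polynomial of [model_conj u f] gives a
    combination of the functions [conj z^(k + 1) u]; each of them is replaced here
    by its Riesz projection, which is [iter k.+1 bshift u]. *)
Definition model_approx u f n : L0 R :=
  \sum_(k < n) conjc (fourier (model_conj u f) k%:Z) *: iter k.+1 (@bshift R) u.

Lemma model_approx_in u f n : inner_function u -> K u (model_approx u f n).
Proof.
move=> iu; apply: (model_sum (F := fun k => conjc (fourier (model_conj u f) k%:Z) *:
  iter k.+1 (@bshift R) u)) => // k _.
apply: modelZ => //; rewrite iterSr; apply: iter_bshift_model => //.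
exact: bshift_inner_model.
Qed.

Lemma model_approx_Linf u f n : inner_function u -> Linf (model_approx u f n).
Proof.
move=> iu; apply: (Linf_sum (F := fun k => conjc (fourier (model_conj u f) k%:Z) *:
  iter k.+1 (@bshift R) u)) => k _.
rewrite L0_scaleE; apply: LinfM; first exact: Linf_cst.
by apply: iter_bshift_Linf; exact: inner_Linf.
Qed.

Lemma antianalytic_sum (c : nat -> C) (F : nat -> L0 R) n :
  (forall k, L2 (F k)) -> (forall k (j : nat), fourier (F k) j%:Z = 0) ->
  forall j : nat, fourier (\sum_(k < n) c k *: F k) j%:Z = 0.
Proof.
move=> lF F0 j; rewrite /fourier (dot_suml (F := fun k => c k *: F k)).
- apply: big1 => k _; rewrite dotZl//; last exact: L2_zpow.
  by rewrite [X in _ * X]F0 mulr0.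
- exact: L2_zpow.
- by move=> k _; apply: L2Z.
Qed.

(** Let [r] be the error made by the Taylor polynomial and [Q] the sum of what the
    Riesz projections removed. Then [f - model_approx u f n = r + Q] belongs to [H2]
    and [Q] is orthogonal to [H2], so this difference is at most [r] in norm. *)
Lemma model_approx_cvg u f : inner_function u -> K u f -> L2_cvg (model_approx u f) f.
Proof.
move=> iu kf; have lf := model_L2 kf; have lu := H2_L2 (inner_H2 iu).
have Hc := model_conj_H2 iu kf; have lc := H2_L2 Hc.
move=> eps eps0; have [N HN] := psum_cvg Hc eps0; exists N => n /HN hn.
set g := model_conj u f in Hc lc hn *.
have lp : L2 (g - psum g n) by apply: L2B => //; exact: L2_psum.
have la : L2 (model_approx u f n) by exact: model_L2 (model_approx_in f n iu).
pose r := f - model_conj u (psum g n).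
have rE : r = u * (L0_conj z * L0_conj (g - psum g n)).
  by rewrite /r -{1}[f](model_conjK f iu) -/g /model_conj L0_conjB !mulrBr.
have l1 : L2 (L0_conj z * L0_conj (g - psum g n)).
  by rewrite -(zpowN1 R); apply: L2_zpowM; exact: L2conj.
have lr : L2 r by rewrite rE; exact: L2_inner.
have nr : nrm r = nrm (psum g n - g).
  rewrite rE nrm_unimod//; [|exact: inner_unimod|exact: L2_inner].
  rewrite -(zpowN1 R) nrm_zpowM; last exact: L2conj.
  by rewrite (nrm_conj lp) (nrmB lc (L2_psum g n)).
pose q k := e (- k.+1%:Z) * psum u k.+1.
have lq k : L2 (q k) by apply: L2_zpowM; exact: L2_psum.
have q0 k (j : nat) : fourier (q k) j%:Z = 0.
  by rewrite fourierM fourier_psum_out//; lia.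
pose Q := \sum_(k < n) conjc (fourier g k%:Z) *: q k.
have lQ : L2 Q.
  by apply: (L2_sum (F := fun k => conjc (fourier g k%:Z) *: q k)) => k _; exact: L2Z.
have E : f - model_approx u f n = r + Q.
  rewrite /r; suff -> : model_conj u (psum g n) = model_approx u f n + Q by rewrite
    opprD addrA subrK.
  rewrite model_conj_psum /model_approx /Q -/g -big_split; apply: eq_bigr => k _ /=.
  rewrite -scalerDr; congr (_ *: _).
  by rewrite -iterS iter_bshift// mulrBr subrK.
have HD : H2 (f - model_approx u f n).
  by apply: H2B; [exact: model_H2 kf|exact: model_H2 (model_approx_in f n iu)].
have lD := H2_L2 HD.
rewrite nrmB// -/(nrm _); apply: le_trans hn; rewrite -[leRHS]nrmB//; last exact: L2_psum.
have e1 : <|f - model_approx u f n, f - model_approx u f n|> = <|r, f - model_approx u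
  f n|>.
  rewrite {1}E dotDl// [X in _ + X](_ : _ = 0) ?addr0//.
  apply: dot_antianalytic => //.
  by apply: (antianalytic_sum (fun k => conjc (fourier g k%:Z))).
have := cauchy_schwarz lr lD; rewrite -e1 nsqE// -nrm_sqr//.
rewrite normc_ReIm /= expr0n addr0 sqrtr_sqr ger0_norm ?sqr_ge0//.
have := nrm_ge0 (f - model_approx u f n); rewrite le_eqVlt => /orP[/eqP <- _|n0].
  exact: nrm_ge0.
by rewrite expr2 ler_pM2r// nr (nrmB (L2_psum g n) lc).
Qed.

End ModelSpace.

(** * Asymmetric truncated Toeplitz operators *)

Section Main.
Variable R : realType.
Local Notation C := R[i].
Implicit Types (f g h u q phi : L0 R) (c : C) (s : nat -> L0 R).
Local Notation "<| f , g |>" := (L2_dot f g) (at level 0, f, g at level 99).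
Local Notation nrm := (@L2_norm R).
Local Notation e := (@L0_zpow R).
Local Notation K := (@model_space R).
Local Notation B := (@bshift R).

(** On the circle [B f conj (B h) = (f - f_0) conj (h - h_0)], since
    [z conj z = 1]; the formula expands this product. *)
Lemma toeplitz_defect phi f h : L2 phi -> Linf f -> L2 h ->
  <|phi * f, h|> - <|phi * B f, B h|> =
  fourier f 0 * <|phi, h|> +
  conjc (fourier h 0) * (<|phi * f, 1|> - fourier f 0 * <|phi, 1|>).
Proof.
move=> lphi bf lh; set a := fourier f 0; set b := fourier h 0.
have lpf : L2 (phi * f) by rewrite mulrC; exact: LinfM_L2.
have lpa : L2 (phi * L0_cst a) by rewrite mulrC -L0_scaleE; exact: L2Z.
have lb : L2 (L0_cst b) by exact: L2_cst.
have -> : <|phi * B f, B h|> = <|phi * f - phi * L0_cst a, h - L0_cst b|>.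
  rewrite /bshift -/a -/b mulrCA dotMl L0_conjK mulrA mul_z_conj mul1r.
  by rewrite mulrBr.
rewrite dotBl ?dotBr//; last exact: L2B.
have ca g : L2 g -> <|g, L0_cst b|> = conjc b * <|g, 1|>.
  by move=> lg; rewrite cstE dotZr//; exact: L2_1.
have cb g : L2 g -> <|phi * L0_cst a, g|> = a * <|phi, g|>.
  by move=> lg; rewrite mulrC -L0_scaleE dotZl.
rewrite !ca// !cb//; [ring|exact: L2_1].
Qed.

Section Operator.
Variables (alpha theta : L0 R) (A : L0 R -> L0 R).
Hypotheses (ia : inner_function alpha) (it : inner_function theta).
Hypothesis bA : bounded_operator (K theta) (K alpha) A.

Lemma op_in f : K theta f -> K alpha (A f). Proof. by case: bA => h _ _; exact: h. Qed.

Lemma op_L2 f : K theta f -> L2 (A f).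
Proof. by move=> kf; exact: model_L2 (op_in kf). Qed.

Lemma op_sub f g : K theta f -> K theta g -> A (f - g) = A f - A g.
Proof.
move=> kf kg; case: bA => _ h _; have := h (-1) g f kg kf.
by rewrite !scaleN1r addrC => ->; rewrite addrC.
Qed.

Lemma op_cvg s f : (forall n, K theta (s n)) -> K theta f -> L2_cvg s f ->
  L2_cvg (A \o s) (A f).
Proof.
move=> ks kf sf eps eps0; case: bA => _ _ [c hc].
have c0 : 0 < `|c| + 1 by rewrite ltr_wpDl.
have [N HN] := sf _ (divr_gt0 eps0 c0); exists N => n /HN hn.
rewrite /= -op_sub//; apply: le_trans (hc _ _) _; first exact: modelB.
have := nrm_ge0 (s n - f); move: (nrm (s n - f)) hn => x.
rewrite ler_pdivlMr// => hn x0; apply: le_trans hn; rewrite mulrC ler_wpM2l//.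
by rewrite (le_trans (ler_norm _))// lerDl.
Qed.

Lemma bshift_cvg s f : (forall n, L2 (s n)) -> L2 f -> L2_cvg s f ->
  L2_cvg (B \o s) (B f).
Proof.
move=> ls lf sf eps eps0; have [N HN] := sf _ eps0; exists N => n /HN hn.
apply: le_trans hn; have -> : (B \o s) n - B f = B (s n - f).
  rewrite /= /bshift fourierB// cstD cstN -mulrBr; congr (_ * _).
  by rewrite !opprD !opprK addrACA.
have lB : L2 (s n - f) by exact: L2B.
by have := nrm_iter_bshift 1 lB; rewrite /= => ->; exact: nrm_psum_le.
Qed.

Lemma compression_dot f h : K theta f -> K alpha h ->
  <|compressed_shift alpha (A (adjoint (K theta) (compressed_shift theta) f)), h|> =
  <|A (B f), B h|>.
Proof.
move=> kf kh; rewrite adjoint_shift//.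
have kb := op_in (model_bshift it kf).
rewrite /compressed_shift model_proj_dot//.
  by apply: dot_zM; [exact: model_H2 kb|exact: model_L2 kh].
by apply: H2_L2; apply: H2_zM; exact: model_H2 kb.
Qed.

Lemma compression_in f : K theta f ->
  K alpha (compressed_shift alpha (A (adjoint (K theta) (compressed_shift theta) f))).
Proof.
move=> kf; rewrite adjoint_shift//; apply: model_proj_in => //.
apply: H2_L2; apply: H2_zM; exact: model_H2 (op_in (model_bshift it kf)).
Qed.

(** The identity of the theorem tested against an element [h] of the target space:
    [<f, k0 theta>] and [<h, k0 alpha>] are the values at 0. *)
Definition defect_form psi chi := forall f h, K theta f -> K alpha h ->
  <|A f, h|> - <|A (B f), B h|> =
  fourier f 0 * <|psi, h|> + conjc (fourier h 0) * <|f, chi|>.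

(** All the vectors involved belong to the target model space, so the operator
    identity may be tested against the elements of this space. *)
Lemma defect_formP psi chi : K alpha psi -> K theta chi ->
  (forall f, K theta f ->
      A f - compressed_shift alpha (A (adjoint (K theta) (compressed_shift theta) f)) =
      rank_one psi (k0 theta) f + rank_one (k0 alpha) chi f) <->
  defect_form psi chi.
Proof.
move=> kpsi kchi.
have rd f h : K theta f -> K alpha h ->
    <|rank_one psi (k0 theta) f + rank_one (k0 alpha) chi f, h|> =
    fourier f 0 * <|psi, h|> + conjc (fourier h 0) * <|f, chi|>.
  move=> kf kh; have lh := model_L2 kh; have lpsi := model_L2 kpsi.
  have lk := model_L2 (k0_model ia).
  rewrite /rank_one dotDl//; [|exact: L2Z|exact: L2Z].
  rewrite !dotZl// dot_k0// [<|k0 alpha, h|>]dotC// dot_k0//.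
  by congr (_ + _); rewrite mulrC.
have ld f h : K theta f -> K alpha h ->
    <|A f - compressed_shift alpha (A (adjoint (K theta) (compressed_shift theta) f)),
      h|> =
    <|A f, h|> - <|A (B f), B h|>.
  move=> kf kh; rewrite dotBl ?compression_dot//; [exact: op_L2| |exact: model_L2 kh].
  exact: model_L2 (compression_in kf).
split=> [H f h kf kh|H f kf]; first by rewrite -ld// H// rd.
apply/eqP; rewrite -subr_eq0; apply/eqP; apply: (@model_eq0 _ alpha).
  apply: modelB => //; first by apply: modelB => //; [exact: op_in|exact: compression_in].
  by apply: modelD => //; apply: modelZ => //; exact: k0_model.
move=> h kh; have lh := model_L2 kh.
rewrite dotBl//; first by rewrite ld// rd// H// subrr.
- by apply: L2B; [exact: op_L2|exact: model_L2 (compression_in kf)].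
- by apply: L2D; apply: L2Z; [exact: model_L2 kpsi|exact: model_L2 (k0_model ia)].
Qed.

(** For bounded [f] the identity is [toeplitz_defect], with [psi] the projection of
    the symbol; both sides are continuous in [f], and bounded functions are dense. *)
Lemma ATTO_defect : ATTO_class theta alpha A ->
  exists psi chi, K alpha psi /\ K theta chi /\ defect_form psi chi.
Proof.
move=> [_ [phi [lphi _ Aphi]]].
have lphic := L2conj lphi.
pose psi := model_proj alpha phi.
(* The multiple of [k0 theta] accounts for the term [- f_0 phi_0]. *)
pose chi := model_proj theta (L0_conj phi) - conjc (<|phi, 1|>) *: k0 theta.
have kpsi : K alpha psi by exact: model_proj_in.
have kchi : K theta chi.
  by apply: modelB => //; [exact: model_proj_in|apply: modelZ => //; exact: k0_model].
exists psi, chi; split=> //; split=> // f h kf kh.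
have lf := model_L2 kf; have lh := model_L2 kh.
have chiE g : K theta g -> <|g, chi|> = <|phi * g, 1|> - fourier g 0 * <|phi, 1|>.
  move=> kg; have lg := model_L2 kg; rewrite dotBr//; last 2 first.
  - exact: model_L2 (model_proj_in it lphic).
  - by apply: L2Z; exact: model_L2 (k0_model it).
  rewrite dot_model_proj// dotZr//; last exact: model_L2 (k0_model it).
  by rewrite dot_k0// conjcK dotMl mulr1 mulrC.
have psiE : <|psi, h|> = <|phi, h|> by exact: model_proj_dot.
have bounded g : K theta g -> Linf g -> <|A g, h|> - <|A (B g), B h|> =
    fourier g 0 * <|psi, h|> + conjc (fourier h 0) * <|g, chi|>.
  move=> kg bg; rewrite psiE chiE// -toeplitz_defect//.
  have AE x y : K theta x -> Linf x -> K alpha y -> <|A x, y|> = <|phi * x, y|>.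
    move=> kx bx ky; have lpx : L2 (phi * x) by rewrite mulrC; exact: LinfM_L2.
    by rewrite Aphi//; exact: model_proj_dot.
  rewrite !AE//; [exact: model_bshift|exact: Linf_bshift|exact: model_bshift].
pose s := model_approx theta f.
have ks n : K theta (s n) by exact: model_approx_in.
have ls n : L2 (s n) by exact: model_L2 (ks n).
have sf : L2_cvg s f by exact: model_approx_cvg.
have kBs n : K theta (B (s n)) by exact: model_bshift.
have kBf : K theta (B f) by exact: model_bshift.
have Bsf : L2_cvg (B \o s) (B f) by exact: bshift_cvg.
have c1 : C_cvg (fun n => <|A (s n), h|> - <|A (B (s n)), B h|>)
    (<|A f, h|> - <|A (B f), B h|>).
  apply: C_cvgB.
  - exact: (dot_cvgl (fun n => op_L2 (ks n)) (op_L2 kf) lh (op_cvg ks kf sf)).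
  - exact: (dot_cvgl (fun n => op_L2 (kBs n)) (op_L2 kBf) (L2_bshift lh) (op_cvg kBs
    kBf Bsf)).
apply: (C_cvg_unique c1).
apply: (C_cvg_eq (a := fun n => <|psi, h|> * fourier (s n) 0 +
    conjc (fourier h 0) * <|s n, chi|>)); last first.
  move=> n; rewrite bounded//; last exact: model_approx_Linf.
  by rewrite [<|psi, h|> * _]mulrC.
rewrite [fourier f 0 * _]mulrC.
apply: C_cvgD; apply: C_cvgM; apply: dot_cvgl => //; first exact: L2_zpow.
exact: model_L2 kchi.
Qed.

Lemma dot_iter_shift psi h n : H2 psi -> L2 h ->
  <|psi, iter n B h|> = <|e n%:Z * psi, h|>.
Proof.
move=> Hpsi lh; elim: n psi Hpsi => [|n IH] psi Hpsi; first by rewrite zpow0 mul1r.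
have lB : L2 (iter n B h) by elim: (n) => //= k; exact: L2_bshift.
rewrite iterS -dot_zM// IH; last exact: H2_zM.
have -> : n.+1%:Z = n%:Z + 1 by lia.
by rewrite zpowD zpow1 mulrA.
Qed.

(** The defect identities of the pairs [B^k f, B^k h] are summed for [k < n]; since
    [(B^k f)_0] is the coefficient [f_k], the terms are [<psi f_k z^k, h>] and
    [<f, chi h_k z^k>]. *)
Lemma defect_iter psi chi n f h : K alpha psi -> K theta chi -> defect_form psi chi ->
  K theta f -> K alpha h -> 
  <|A f, h|> - <|A (iter n B f), iter n B h|> = <|psi * psum f n, h|> + <|f, chi * psum
    h n|>.
Proof.
move=> kpsi kchi D kf kh.
have lf := model_L2 kf; have lh := model_L2 kh.
have Hpsi := model_H2 kpsi; have Hchi := model_H2 kchi.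
have lpsi := H2_L2 Hpsi; have lchi := H2_L2 Hchi.
have bp g k : Linf (psum g k).
  apply: (Linf_sum (F := fun k : nat => fourier g k%:Z *: e k%:Z)) => j _.
  by rewrite L0_scaleE; apply: LinfM; [exact: Linf_cst|exact: Linf_zpow].
have lp g q k : L2 q -> L2 (q * psum g k) by rewrite mulrC; exact: LinfM_L2.
elim: n => [|n IH].
  by rewrite /psum !big_ord0 !mulr0 dot0l dot0r addr0 subrr.
have kfn := iter_bshift_model n it kf; have khn := iter_bshift_model n ia kh.
rewrite !iterS; move/(congr1 (fun x => x + (<|A (iter n B f), iter n B h|> -
   <|A (B (iter n B f)), B (iter n B h)|>))) : IH; rewrite addrA subrK => ->.
have lm g q : L2 q -> L2 (q * (fourier g n%:Z *: e n%:Z)).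
  by move=> lq; rewrite L0_scaleE mulrCA -L0_scaleE; apply: L2Z; rewrite mulrC; exact:
    L2_zpowM.
rewrite (D _ _ kfn khn) !psumS !mulrDr (dotDl (lp f _ n lpsi) (lm f _ lpsi) lh).
rewrite (dotDr (lp h _ n lchi) (lm h _ lchi) lf).
have f0 g : L2 g -> fourier (iter n B g) 0 = fourier g n%:Z.
  move=> lg; rewrite iter_bshift// fourierM sub0r opprK fourierB//; last exact: L2_psum.
  by rewrite fourier_psum_out ?subr0// lexx orbT.
rewrite !f0//.
have -> : <|psi * (fourier f n%:Z *: e n%:Z), h|> = fourier f n%:Z * <|psi, iter n B h|>.
  rewrite L0_scaleE mulrCA -L0_scaleE dotZl//; last by rewrite mulrC; exact: L2_zpowM.
  by rewrite dot_iter_shift// (mulrC psi).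
have -> : <|f, chi * (fourier h n%:Z *: e n%:Z)|> = conjc (fourier h n%:Z) * <|iter n B
  f, chi|>.
  rewrite L0_scaleE mulrCA -L0_scaleE dotZr//; last by rewrite mulrC; exact: L2_zpowM.
  congr (_ * _); rewrite [RHS]dotC//; last exact: model_L2 kfn.
  by rewrite dot_iter_shift// (mulrC chi) -dotC//; exact: L2_zpowM.
by rewrite addrACA.
Qed.

(** The symbol is [phi = psi + conj chi]. For bounded [f] and [h] the limit of
    [defect_iter] is [<A f, h> = <phi f, h>], and density of the bounded functions
    removes first the assumption on [f] and then the one on [h]. *)
Lemma defect_ATTO psi chi : K alpha psi -> K theta chi -> defect_form psi chi ->
  ATTO_class theta alpha A.
Proof.
move=> kpsi kchi D.
have Hpsi := model_H2 kpsi; have Hchi := model_H2 kchi.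
have lpsi := H2_L2 Hpsi; have lchi := H2_L2 Hchi.
have lchic := L2conj lchi.
pose phi := psi + L0_conj chi.
have lphi : L2 phi by exact: L2D.
have lphic := L2conj lphi.
(* Boundedness of [h] makes [conj psi h] square integrable, and boundedness of [f]
   makes [conj chi f] so; hence the partial sums may converge in norm only. *)
have Ab f h : K theta f -> Linf f -> K alpha h -> Linf h ->
    <|A f, h|> = <|f, L0_conj phi * h|>.
  move=> kf bf kh bh.
  have lf := model_L2 kf; have lh := model_L2 kh.
  have Hf := model_H2 kf; have Hh := model_H2 kh.
  have kfn n := iter_bshift_model n it kf; have khn n := iter_bshift_model n ia kh.
  (* The remainder tends to 0: [B^n f] does, and [B^n h] stays bounded. *)
  have c0 : C_cvg (fun n => <|A (iter n B f), iter n B h|>) 0.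
    have [_ _ [c hc]] := bA.
    move=> eps eps0.
    have M0 : 0 < `|c| * nrm h + 1 by rewrite ltr_wpDl// mulr_ge0// nrm_ge0.
    have [N HN] := psum_cvg Hf (divr_gt0 eps0 M0); exists N => n /HN.
    rewrite nrmB//; last exact: L2_psum.
    rewrite -nrm_iter_bshift// subr0 => hn.
    apply: le_trans (cauchy_schwarz (op_L2 (kfn n)) (model_L2 (khn n))) _.
    apply: (@le_trans _ _ ((`|c| * nrm (iter n B f)) * nrm h)).
      apply: ler_pM; [exact: nrm_ge0|exact: nrm_ge0| |].
        apply: le_trans (hc _ (kfn n)) _; rewrite ler_wpM2r ?nrm_ge0//; exact: ler_norm.
      by rewrite nrm_iter_bshift//; exact: nrm_psum_le.
    move: hn; rewrite ler_pdivlMr// => hn; apply: le_trans hn.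
    by rewrite mulrAC mulrC ler_wpM2l ?nrm_ge0// lerDl.
  have c1 : C_cvg (fun n => <|psi * psum f n, h|> + <|f, chi * psum h n|>)
      (<|f, L0_conj psi * h|> + <|L0_conj chi * f, h|>).
    apply: C_cvgD.
    - apply: (C_cvg_eq (a := fun n => <|psum f n, L0_conj psi * h|>)); last first.
        by move=> n; rewrite dotMl.
      apply: dot_cvgl => //; [by move=> n; exact: L2_psum| |exact: psum_cvg].
      by rewrite mulrC; apply: LinfM_L2 => //; exact: L2conj.
    - apply: (C_cvg_eq (a := fun n => <|L0_conj chi * f, psum h n|>)); last first.
        by move=> n; rewrite dotMl L0_conjK.
      apply: dot_cvgr => //; [by move=> n; exact: L2_psum| |exact: psum_cvg].
      by rewrite mulrC; exact: LinfM_L2.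
  have c2 : C_cvg (fun n => <|A f, h|> - <|A (iter n B f), iter n B h|>) (<|A f, h|> - 0).
    by apply: C_cvgB => //; exact: C_cvg_cst.
  rewrite subr0 in c2.
  have c3 := C_cvg_eq c2 (fun n => @defect_iter psi chi n f h kpsi kchi D kf kh).
  rewrite (C_cvg_unique c3 c1) dotMl L0_conjK /phi L0_conjD L0_conjK mulrDl dotDr//.
  - by rewrite mulrC; apply: LinfM_L2 => //; exact: L2conj.
  - by rewrite mulrC; apply: LinfM_L2.
(* For bounded [h] both sides are continuous in [f]. *)
have Af f h : K theta f -> K alpha h -> Linf h -> <|A f, h|> = <|f, L0_conj phi * h|>.
  move=> kf kh bh; have lh := model_L2 kh.
  pose s := model_approx theta f.
  have ks n : K theta (s n) by exact: model_approx_in.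
  have ls n : L2 (s n) by exact: model_L2 (ks n).
  have sf : L2_cvg s f by exact: model_approx_cvg.
  have c1 : C_cvg (fun n => <|A (s n), h|>) <|A f, h|>.
    exact: (dot_cvgl (fun n => op_L2 (ks n)) (op_L2 kf) lh (op_cvg ks kf sf)).
  have c2 : C_cvg (fun n => <|s n, L0_conj phi * h|>) <|f, L0_conj phi * h|>.
    apply: dot_cvgl => //; first exact: model_L2 kf.
    by rewrite mulrC; exact: LinfM_L2.
  apply: (C_cvg_unique c1); apply: (C_cvg_eq c2) => n.
  by rewrite Ab//; exact: model_approx_Linf.
have Adom f : ATTO_dom phi theta f -> A f = ATTO phi alpha f.
  move=> [kf lpf]; apply/eqP; rewrite -subr_eq0; apply/eqP.
  have kP : K alpha (ATTO phi alpha f) by exact: model_proj_in.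
  have kd : K alpha (A f - ATTO phi alpha f) by apply: modelB => //; exact: op_in.
  set d := A f - _ in kd *.
  have ld := model_L2 kd.
  apply: (dot_eq0 ld).
  have c1 : C_cvg (fun n => <|d, model_approx alpha d n|>) <|d, d|>.
    apply: dot_cvgr => //; last exact: model_approx_cvg.
    by move=> n; exact: model_L2 (model_approx_in d n ia).
  apply: (C_cvg_eventually (N := 0) c1) => n _.
  have kn := model_approx_in d n ia.
  rewrite /d dotBl; [|exact: op_L2|exact: model_L2 kP|exact: model_L2 kn].
  rewrite Af//; last exact: model_approx_Linf.
  by rewrite [X in _ - X]model_proj_dot// dotMl subrr.
split=> //; exists phi; split=> //.
have [_ _ [c hc]] := bA; exists c => f df; rewrite -Adom//.
by apply: hc; case: df.
Qed.

End Operator.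
End Main.

Theorem theorem5p1 (R : realType) (alpha theta : L0 R) (A : L0 R -> L0 R)
    (inner_alpha : inner_function alpha) (nonconstant_alpha : nonconstant alpha)
    (inner_theta : inner_function theta) (nonconstant_theta : nonconstant theta)
    (alpha_theta : inner_divides alpha theta)
    (bounded_A : bounded_operator (model_space theta) (model_space alpha) A) :
  ATTO_class theta alpha A <->
  exists psi chi : L0 R, model_space alpha psi /\ model_space theta chi /\
    forall f : L0 R, model_space theta f ->
      A f - compressed_shift alpha
              (A (adjoint (model_space theta) (compressed_shift theta) f)) =
      rank_one psi (k0 theta) f + rank_one (k0 alpha) chi f.
Proof.
split=> [/(ATTO_defect inner_alpha inner_theta bounded_A)|] [psi [chi [kpsi [kchi H]]]].
  by exists psi, chi; do 2 split => //; apply/defect_formP.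
apply: (@defect_ATTO R alpha theta A inner_alpha inner_theta bounded_A psi chi) => //.
exact/(defect_formP inner_alpha inner_theta bounded_A kpsi kchi).
Qed.
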